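(* Let $\lambda_1,\dots,\lambda_k$ be $k$ distinct points in $\mathbb B_n$ and let $W_1,\dots,W_k\in B(\mathcal K)$, where $\mathcal K$ is a Hilbert space. If the operator matrix $$\left[\frac{I_{\mathcal K}-W_jW_i^*}{1-\langle\lambda_j,\lambda_i\rangle}\right]_{i,j=1,\dots,k}$$ is positive definite, i.e. $\sum_{i,j=1}^k \frac{\langle (I_{\mathcal K}-W_jW_i^* )h_i,h_j\rangle}{1-\langle\lambda_j,\lambda_i\rangle}\ge 0$ for all $h_1,\dots,h_k\in\mathcal K$, then there is an operator-valued analytic function $F:\mathbb B_n\to B(\mathcal K)$ such that $$\sup_{\zeta\in\mathbb B_n}\|F(\zeta)\|\le1\quad\text{and}\quad F(\lambda_j)=W_j\ \text{ for every } j=1,\dots,k.$$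
   Context: Let $1\le n\le\aleph_0$; $\mathbb B_n$ is the open unit ball of $\mathbb C^n$ (read $\mathbb C^n$ as $\ell^2$ if $n=\aleph_0$), with inner product $\langle\lambda,\mu\rangle=\sum_i\lambda_i\overline{\mu_i}$. $B(\mathcal K)$ is the algebra of bounded linear operators on $\mathcal K$. *)

(* Defs.v *)
From HB Require Import structures.
From mathcomp Require Import all_boot all_order all_algebra.
From mathcomp Require Import all_classical all_reals all_analysis.
From mathcomp Require Import complex ring.

Set Implicit Arguments.
Unset Strict Implicit.
Unset Printing Implicit Defensive.

Import Order.TTheory GRing.Theory Num.Theory.
Import numFieldNormedType.Exports.

Local Open Scope classical_set_scope.
Local Open Scope ring_scope.

(* The norm of a normed module over R[i] takes its values in R[i]; [rnorm x]
   is the same quantity as an element of R. *)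
Definition rnorm (R : realType) (V : normedZmodType R[i]) (x : V) : R :=
  complex.Re `|x|.

Section rnorm_theory.
Context (R : realType) (V : normedZmodType R[i]).
Implicit Types x y : V.
Local Open Scope complex_scope.

Lemma rnormE x : (rnorm x)%:C = `|x|.
Proof. by rewrite /rnorm RRe_real// ger0_real ?normr_ge0. Qed.

Lemma rnorm_ge0 x : 0 <= rnorm x.
Proof. by rewrite -ler0c rnormE normr_ge0. Qed.

Lemma rnormD x y : rnorm (x + y) <= rnorm x + rnorm y.
Proof. by rewrite -lecR rmorphD/= !rnormE ler_normD. Qed.

Lemma rnorm0 : rnorm (0 : V) = 0.
Proof. by rewrite /rnorm normr0. Qed.

Lemma rnorm0_eq0 x : rnorm x = 0 -> x = 0.
Proof. by move=> h; apply/normr0_eq0; rewrite -rnormE h. Qed.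

End rnorm_theory.

Lemma rnormM (R : realType) (a b : R[i]) : rnorm (a * b) = rnorm a * rnorm b.
Proof. by apply: complexI; rewrite rmorphM/= !rnormE normrM. Qed.

Lemma rnormZ (R : realType) (V : normedModType R[i]) (a : R[i]) (x : V) :
  rnorm (a *: x) = rnorm a * rnorm x.
Proof. by apply: complexI; rewrite rmorphM/= !rnormE normrZ. Qed.

(* A dimension 1 <= n <= aleph_0 is an [option nat], aleph_0 being [None].
   The space [l2 R n] consists of the square-summable complex sequences that
   vanish at all indices i >= n: it is C^n with its Euclidean norm if n is
   finite, and l^2 otherwise. *)
Definition in_dim (n : option nat) (i : nat) : bool :=
  if n is Some m then (i < m)%N else true.

Section l2.
Context (R : realType) (n : option nat).
Local Notation C := (R[i]).
Implicit Types x y : nat -> C.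

Definition sqs x : R ^nat := series (fun i => rnorm (x i) ^+ 2).

Definition is_l2 x : Prop :=
  (forall i, ~~ in_dim n i -> x i = 0) /\ cvgn (sqs x).

Definition l2_pred : {pred (nat -> C)} := [pred x | `[< is_l2 x >]].

Record l2 := L2 { l2val :> nat -> C ; _ : l2val \in l2_pred }.

HB.instance Definition _ := [isSub for l2val].
HB.instance Definition _ := [Choice of l2 by <:].

Lemma sqs_nd x : nondecreasing_seq (sqs x).
Proof. by apply: nondecreasing_series => i _ _; rewrite sqr_ge0. Qed.

Lemma sqs_le_lim x N : cvgn (sqs x) -> sqs x N <= limn (sqs x).
Proof. by move=> cx; apply: nondecreasing_cvgn_le => //; exact: sqs_nd. Qed.

Lemma sqs_lim_ge0 x : 0 <= limn (sqs x).
Proof.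
have [cx|/dvgP ->//] := pselect (cvgn (sqs x)).
by have := sqs_le_lim 0 cx; apply: le_trans; rewrite /sqs /series/= big_geq.
Qed.

Lemma sqs_bounded x (M : R) : (forall N, sqs x N <= M) ->
  cvgn (sqs x) /\ limn (sqs x) <= M.
Proof.
move=> xM; have cx : cvgn (sqs x).
  apply: nondecreasing_is_cvgn; first exact: sqs_nd.
  by exists M => _ [N _ <-].
by split=> //; apply: limr_le => //; near=> N.
Unshelve. all: by end_near. Qed.

Definition l2norm_seq x : R := Num.sqrt (limn (sqs x)).

Lemma l2norm_seq_eq0 x : cvgn (sqs x) -> l2norm_seq x = 0 -> x = 0.
Proof.
move=> cx /eqP; rewrite sqrtr_eq0 => x0; apply/funext => i.
apply: rnorm0_eq0; apply/eqP; rewrite -sqrf_eq0 eq_le sqr_ge0 andbT.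
apply: le_trans x0; apply: le_trans (sqs_le_lim i.+1 cx).
rewrite /sqs /series/= big_nat_recr//= lerDr.
by apply: sumr_ge0 => j _; rewrite sqr_ge0.
Qed.

Lemma l2norm_seqZ a x : cvgn (sqs x) ->
  cvgn (sqs (a *: x)) /\ l2norm_seq (a *: x) = rnorm a * l2norm_seq x.
Proof.
move=> cx; have E : sqs (a *: x) = (fun N => rnorm a ^+ 2 * sqs x N).
  apply/funext => N; rewrite /sqs /series/= mulr_sumr.
  by apply: eq_bigr => i _; rewrite fctE rnormM exprMn.
have h : sqs (a *: x) @ \oo --> rnorm a ^+ 2 * limn (sqs x).
  by rewrite E; apply: cvgMr.
split; first by apply/cvg_ex; eexists; exact: h.
rewrite /l2norm_seq (cvg_lim _ h)// sqrtrM ?sqr_ge0// sqrtr_sqr.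
by rewrite ger0_norm// rnorm_ge0.
Qed.

Lemma l2norm_seqD x y : cvgn (sqs x) -> cvgn (sqs y) ->
  cvgn (sqs (x + y)) /\ l2norm_seq (x + y) <= l2norm_seq x + l2norm_seq y.
Proof.
move=> cx cy.
have [x0|xn0] := eqVneq (l2norm_seq x) 0.
  by rewrite x0 (l2norm_seq_eq0 cx x0) !add0r.
have [y0|yn0] := eqVneq (l2norm_seq y) 0.
  by rewrite y0 (l2norm_seq_eq0 cy y0) !addr0.
set X := l2norm_seq x; set Y := l2norm_seq y.
have X0 : 0 < X by rewrite lt_def xn0 sqrtr_ge0.
have Y0 : 0 < Y by rewrite lt_def yn0 sqrtr_ge0.
suff h N : sqs (x + y) N <= (X + Y) ^+ 2.
  have [c l] := sqs_bounded h; split=> //.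
  rewrite -[leRHS]ger0_norm; last by rewrite addr_ge0 ?ltW.
  by rewrite -sqrtr_sqr ler_sqrt// sqr_ge0.
have pt (a b : R) : (a + b) ^+ 2 <= (1 + Y / X) * a ^+ 2 + (1 + X / Y) * b ^+ 2.
  rewrite -subr_ge0.
  suff -> : (1 + Y / X) * a ^+ 2 + (1 + X / Y) * b ^+ 2 - (a + b) ^+ 2 =
            (Y * a - X * b) ^+ 2 / (X * Y) by rewrite divr_ge0 ?sqr_ge0// mulr_ge0 ?ltW.
  by field; rewrite xn0 yn0.
have -> : (X + Y) ^+ 2 = (1 + Y / X) * X ^+ 2 + (1 + X / Y) * Y ^+ 2.
  by field; rewrite xn0 yn0.
apply: (@le_trans _ _ ((1 + Y / X) * sqs x N + (1 + X / Y) * sqs y N)).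
  rewrite /sqs /series/= !mulr_sumr -big_split/=; apply: ler_sum => i _.
  apply: le_trans (pt _ _); rewrite fctE lerXn2r// ?nnegrE ?addr_ge0 ?rnorm_ge0//.
  exact: rnormD.
by apply: lerD; apply: ler_wpM2l; rewrite ?sqr_sqrtr ?sqs_lim_ge0 ?sqs_le_lim//
  addr_ge0// divr_ge0// ltW.
Qed.

Lemma l2_submod_closed : submod_closed l2_pred.
Proof.
split.
  apply/asboolP; split=> //; have -> : sqs 0 = fun=> 0.
    by apply/funext => N; rewrite /sqs /series/= big1// => i _;
      rewrite rnorm0 expr0n.
  exact: is_cvg_cst.
move=> a x y /asboolP[x0 cx] /asboolP[y0 cy]; apply/asboolP; split.
  by move=> i ni; rewrite !fctE x0// y0// scaler0 addr0.
by apply: (l2norm_seqD _ cy).1; exact: (l2norm_seqZ a cx).1.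
Qed.

HB.instance Definition _ := GRing.isSubmodClosed.Build _ _ l2_pred l2_submod_closed.
HB.instance Definition _ := [SubChoice_isSubLmodule of l2 by <:].

Lemma l2_cvg (x : l2) : cvgn (sqs x).
Proof. by have /asboolP[] := valP x. Qed.

Definition l2norm (x : l2) : C := (l2norm_seq x)%:C%C.

Lemma l2normD (x y : l2) : l2norm (x + y) <= l2norm x + l2norm y.
Proof.
rewrite /l2norm -rmorphD/= lecR.
by have [_] := l2norm_seqD (@l2_cvg x) (@l2_cvg y).
Qed.

Lemma l2normZ (a : C) (x : l2) : l2norm (a *: x) = `|a| * l2norm x.
Proof.
by rewrite /l2norm -rnormE -rmorphM/= -(l2norm_seqZ a (@l2_cvg x)).2.
Qed.

Lemma l2norm0_eq0 (x : l2) : l2norm x = 0 -> x = 0.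
Proof.
by move=> /complexI /(l2norm_seq_eq0 (@l2_cvg x)) x0; exact/val_inj.
Qed.

HB.instance Definition _ :=
  Lmodule_isNormed.Build C l2 l2normD l2normZ l2norm0_eq0.

Definition l2dot (x y : l2) : C :=
  limn (series (fun i => x i * (y i)^*%C : C^o)).

Definition l2ball : set l2 := [set x | `|x| < 1].

End l2.

Arguments l2ball : clear implicits.

(* [bop K] is B(K), with the operator norm. *)
Section bounded_operators.
Context (R : realType) (K : normedModType R[i]).
Local Notation C := (R[i]).
Implicit Types f g : K -> K.

Definition is_bop f : Prop :=
  linear f /\ exists M : C, forall x, `|f x| <= M * `|x|.

Definition bop_pred : {pred (K -> K)} := [pred f | `[< is_bop f >]].

Record bop := Bop { bopval :> K -> K ; _ : bopval \in bop_pred }.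

HB.instance Definition _ := [isSub for bopval].
HB.instance Definition _ := [Choice of bop by <:].

Lemma bop_submod_closed : submod_closed bop_pred.
Proof.
split.
  apply/asboolP; split; first by move=> a x y; rewrite scaler0 addr0.
  by exists 0 => x; rewrite normr0 mul0r.
move=> a f g /asboolP[lf [M fM]] /asboolP[lg [N gN]]; apply/asboolP; split.
  move=> b x y; rewrite !fctE lf lg !scalerDr !scalerA (mulrC a b).
  by rewrite addrACA.
exists (`|a| * M + N) => x; rewrite !fctE mulrDl.
rewrite (le_trans (ler_normD _ _))// lerD// normrZ -mulrA.
by rewrite ler_wpM2l.
Qed.

HB.instance Definition _ := GRing.isSubmodClosed.Build _ _ bop_pred bop_submod_closed.
HB.instance Definition _ := [SubChoice_isSubLmodule of bop by <:].

Definition opnorm (T : bop) : R := sup [set rnorm (T x) | x in [set x | `|x| <= 1]].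

Lemma bopP (T : bop) : is_bop T.
Proof. by have /asboolP := valP T. Qed.

Lemma bop_linear (T : bop) : linear T.
Proof. by have [] := bopP T. Qed.

Lemma bop0 (T : bop) : T 0 = 0.
Proof.
have /eqP := bop_linear T 1 0 0.
by rewrite !scale1r addr0 -[X in X == _]addr0 (inj_eq (addrI _)) => /eqP.
Qed.

Lemma opnorm_has_sup (T : bop) :
  has_sup [set rnorm (T x) | x in [set x | `|x| <= 1]].
Proof.
split; first by exists (rnorm (T 0)); exists 0 => //=; rewrite normr0.
have [_ [M TM]] := bopP T; exists (rnorm M) => _ [x /= x1 <-].
have : `|T x| <= `|M| * 1.
  rewrite (le_trans (TM x))//.
  have [/normr0P/eqP ->|x0] := eqVneq `|x| 0.
    by rewrite normr0 mulr0 mulr1.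
  have M0 : 0 <= M.
    rewrite -(pmulr_lge0 (x:=`|x|)) ?(le_trans _ (TM x))//.
    by rewrite lt_def x0 normr_ge0.
  by rewrite ger0_norm// ler_wpM2l.
by rewrite mulr1 -!rnormE lecR.
Qed.

Lemma le_opnorm1 (T : bop) x : `|x| <= 1 -> rnorm (T x) <= opnorm T.
Proof.
by move=> x1; apply: ub_le_sup; [exact: (opnorm_has_sup T).2|exists x].
Qed.

Lemma opnorm_le (T : bop) (M : R) :
  (forall x, `|x| <= 1 -> rnorm (T x) <= M) -> opnorm T <= M.
Proof.
by move=> h; apply: ge_sup; [exact: (opnorm_has_sup T).1|move=> _ [x /= + <-]; exact: h].
Qed.

Lemma opnorm_ge0 (T : bop) : 0 <= opnorm T.
Proof.
by apply: le_trans (le_opnorm1 T (x := 0) _); rewrite ?rnorm_ge0// normr0.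
Qed.

Lemma opnormD (S T : bop) : opnorm (S + T) <= opnorm S + opnorm T.
Proof.
apply: opnorm_le => x x1; rewrite (le_trans (rnormD _ _))//.
by rewrite lerD// le_opnorm1.
Qed.

Lemma opnormZ_le a (T : bop) : opnorm (a *: T) <= rnorm a * opnorm T.
Proof.
apply: opnorm_le => x x1; have -> : (a *: T) x = a *: T x by [].
by rewrite rnormZ ler_wpM2l ?rnorm_ge0// le_opnorm1.
Qed.

Definition bopnorm (T : bop) : C := (opnorm T)%:C%C.

Lemma bopnormD (S T : bop) : bopnorm (S + T) <= bopnorm S + bopnorm T.
Proof. by rewrite /bopnorm -rmorphD/= lecR opnormD. Qed.

Lemma bopnormZ a (T : bop) : bopnorm (a *: T) = `|a| * bopnorm T.
Proof.
rewrite /bopnorm -rnormE -rmorphM/=; congr (_%:C)%C.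
apply/eqP; rewrite eq_le opnormZ_le/=.
have [->|a0] := eqVneq a 0; first by rewrite rnorm0 mul0r opnorm_ge0.
have ra0 : 0 < rnorm a.
  by rewrite lt_def rnorm_ge0 andbT; apply: contra_neq a0; exact: rnorm0_eq0.
rewrite -ler_pdivlMl//.
have -> : opnorm T = opnorm (a^-1 *: (a *: T)).
  by rewrite scalerA mulVf// scale1r.
rewrite (le_trans (opnormZ_le _ _))// ler_wpM2r ?opnorm_ge0//.
rewrite -(ler_pM2l ra0) -rnormM divff// divff ?gt_eqF//.
by rewrite /rnorm normr1.
Qed.

Lemma bopnorm0_eq0 (T : bop) : bopnorm T = 0 -> T = 0.
Proof.
move=> /complexI T0; apply/val_inj/funext => x /=.
change (T x = 0).
have [->|x0] := eqVneq x 0; first exact: bop0.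
have nx0 : `|x| != 0 by rewrite normr_eq0.
have : rnorm (T (`|x|^-1 *: x)) <= 0.
  rewrite -T0 le_opnorm1// normrZ ger0_norm ?invr_ge0// mulVf//.
have -> : T (`|x|^-1 *: x) = `|x|^-1 *: T x.
  by have := bop_linear T `|x|^-1 x 0; rewrite bop0 !addr0.
move=> h; have /rnorm0_eq0/eqP : rnorm (`|x|^-1 *: T x) = 0.
  by apply/eqP; rewrite eq_le h rnorm_ge0.
by rewrite scaler_eq0 invr_eq0 (negbTE nx0)/= => /eqP.
Qed.

HB.instance Definition _ :=
  Lmodule_isNormed.Build C bop bopnormD bopnormZ bopnorm0_eq0.

(* [adjoint dot T] is T^* with respect to the inner product [dot].  The
   default value 0 is irrelevant in a Hilbert space, where every bounded
   operator has exactly one adjoint. *)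
Definition adjoint (dot : K -> K -> C) (T : bop) : bop :=
  xget 0 [set S : bop | forall x y, dot (T x) y = dot x (S y)].

End bounded_operators.

(* Analyticity between normed spaces over R[i]: near each point, the function
   is the uniform sum of a series of continuous homogeneous polynomials, a
   continuous m-homogeneous polynomial being the restriction to the diagonal
   of a bounded m-linear map. *)
Section analytic.
Context (R : realType) (E F : normedModType R[i]).
Local Notation C := (R[i]).

Definition subst_at m (v : 'I_m -> E) (i : 'I_m) (x : E) : 'I_m -> E :=
  fun j => if j == i then x else v j.

Definition multilinear m (A : ('I_m -> E) -> F) : Prop :=
  forall (v : 'I_m -> E) (i : 'I_m), linear (fun x => A (subst_at v i x)).

Definition bounded_multilinear m (A : ('I_m -> E) -> F) : Prop :=
  multilinear A /\
  exists M : C, forall v, `|A v| <= M * \prod_(i < m) `|v i|.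

Definition homogeneous_polynomial m (P : E -> F) : Prop :=
  exists2 A : ('I_m -> E) -> F,
    bounded_multilinear A & forall x, P x = A (fun=> x).

Definition analytic_on (U : set E) (f : E -> F) : Prop :=
  forall a, U a -> exists r : C, exists P : nat -> E -> F,
    [/\ 0 < r, ball a r `<=` U, forall m, homogeneous_polynomial m (P m) &
      {uniform ball a r, (fun N z => \sum_(m < N) P m (z - a)) @ \oo --> f}].

End analytic.

(* Main.v *)
Require Import Defs.
From HB Require Import structures.
From mathcomp Require Import all_boot all_order all_algebra.
From mathcomp Require Import all_classical all_reals all_analysis.
From mathcomp Require Import complex ring lra.

Set Implicit Arguments.
Unset Strict Implicit.
Unset Printing Implicit Defensive.

Import Order.TTheory GRing.Theory Num.Theory.
Import numFieldNormedType.Exports.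

Local Open Scope classical_set_scope.
Local Open Scope ring_scope.

(** The interpolant is the transfer function of a contraction that can be read
off from the data.  Write W_i' for the adjoint of W_i.  The positive operator
matrix of the hypothesis has a square root B on K^k, so the maps
gam_i u := B (u placed at index i) factor it:
   <gam_i u, gam_j v> = <(1 - W_j W_i') u, v> / (1 - <lam_j, lam_i>).
Clearing the denominator gives
   <u, v> + <lam_j, lam_i> <gam_i u, gam_j v>
      = <W_i' u, W_j' v> + <gam_i u, gam_j v>,
and this says that the map
   (sum_i W_i' h_i, sum_i gam_i h_i)
      |-> (sum_i h_i, sum_i gam_i h_i (x) conj lam_i)
is isometric.  Extended by zero on the orthogonal complement of its domain
inside K + G, it becomes a contraction.  Let V be its first component.
Pairing its second component with a point z of the ball turns the tensors
gam_i h_i (x) conj lam_i into <z, lam_i> gam_i h_i; this yields an operator L_z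
with values in 0 + G that is linear in z and satisfies |L_z x| <= |z| |x|.
Hence x = (u, 0) + L_z x has exactly one solution x, and F(z) u := V x.

The three properties of F are then short.  As (u, 0) and L_z x are orthogonal,
|V x|^2 + |L_z x|^2 <= |x|^2 = |u|^2 + |L_z x|^2, so F(z) is a contraction.
Pairing the fixed point equation at z = lam_j with (W_j' v, gam_j v), which lies
in the domain of the isometry, gives <F(lam_j) u, v> = <u, W_j' v>.  And
F(z) = V (1 - L_z)^-1 (_, 0), whose Neumann series around any point a of the
ball consists of homogeneous polynomials in z - a.

The tensor product with l2 is never formed: only the numbers <lam_j, lam_i> and
<z, lam_i> occur, and [tensor_contraction] supplies the one inequality about it
that is needed.  The analytic input is [range_riesz], which produces both
adjoints and orthogonal projections, [positive_factor] for the square root,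
[range_extension] for the contraction, and [transfer_analytic] for the power
series; [lurking_isometry] combines them. *)

(** * Norm and convergence of a definite hermitian form *)

Section complex_parts.
Context (R : realType).
Implicit Types a b : R[i].
Local Notation Re := complex.Re.
Local Notation Im := complex.Im.

Lemma Re_add a b : Re (a + b) = Re a + Re b.
Proof. by case: a; case: b. Qed.

Lemma Re_opp a : Re (- a) = - Re a.
Proof. by case: a. Qed.

Lemma Re_realM (t : R) a : Re (t%:C%C * a) = t * Re a.
Proof. by case: a => a1 a2 /=; ring. Qed.

Lemma Re_sum (I : Type) (r : seq I) (P : pred I) (F : I -> R[i]) :
  Re (\sum_(i <- r | P i) F i) = \sum_(i <- r | P i) Re (F i).
Proof. by elim/big_rec2: _ => // i x y _ <-; rewrite Re_add. Qed.

Lemma rnorm_sqr a : rnorm a ^+ 2 = Re a ^+ 2 + Im a ^+ 2.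
Proof. by apply: complexI; rewrite rmorphXn/= rnormE -add_Re2_Im2. Qed.

Lemma Re_le_rnorm a : Re a <= rnorm a.
Proof.
apply: le_trans (ler_norm _) _.
by rewrite -lecR rnormE normc_ge_Re.
Qed.

Lemma rnorm_real (t : R) : rnorm t%:C%C = `|t|.
Proof.
apply: complexI; rewrite rnormE normc_def/= expr0n addr0 sqrtr_sqr//.
Qed.

Lemma rnorm_conj a : rnorm a^* = rnorm a.
Proof. by rewrite /rnorm -[LHS]/(Re `|a^*%C|) normcJ. Qed.

Lemma rnormN (V : normedZmodType R[i]) (x : V) : rnorm (- x) = rnorm x.
Proof. by rewrite /rnorm normrN. Qed.

Lemma ge0_ReK a : 0 <= a -> a = (Re a)%:C%C.
Proof. by case: a => x y; rewrite lecE/= => /andP[/eqP-> _]. Qed.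

Lemma ge0_Re_ge0 a : 0 <= a -> 0 <= Re a.
Proof. by case: a => x y; rewrite lecE/= => /andP[]. Qed.

Lemma squeeze0 (u v : R^nat) : (forall n, 0 <= u n <= v n) ->
  v @ \oo --> (0 : R) -> u @ \oo --> (0 : R).
Proof.
move=> uv v0; apply: (squeeze_cvgr _ (cvg_cst 0) v0).
by near=> n; exact: uv.
Unshelve. all: by end_near. Qed.

End complex_parts.

Section positive_forms.
Context (R : realType) (V : lmodType R[i]) (f : V -> V -> R[i]).
Local Notation Re := complex.Re.
Local Notation Im := complex.Im.
Hypothesis f_linl : forall y a x1 x2, f (a *: x1 + x2) y = a * f x1 y + f x2 y.
Hypothesis f_linr :
  forall x a y1 y2, f x (a *: y1 + y2) = a^* * f x y1 + f x y2.
Hypothesis f_ge0 : forall x, 0 <= f x x.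

(** The diagonal values at x + y and at ix + y are real; their imaginary parts
    determine the difference between f y x and the conjugate of f x y. *)
Lemma positive_form_herm x y : f y x = (f x y)^*.
Proof.
have := f_ge0 (1 *: x + y); have := f_ge0 ('i%C *: x + y).
rewrite !f_linl !f_linr.
have := f_ge0 x; have := f_ge0 y.
case: (f x x) => a1 a2; case: (f y y) => b1 b2.
case: (f x y) => c1 c2; case: (f y x) => d1 d2.
rewrite !lecE/= => /andP[/eqP b20 _] /andP[/eqP a20 _].
move=> /andP[/eqP h1 _] /andP[/eqP h2 _].
by congr (Complex _ _); lra.
Qed.

(** Stated for semidefinite forms because it is applied to <A x, y> with A
    positive, where vectors may have norm zero: positivity at x - t (f x y) y is
    a quadratic inequality in the real parameter t, used at t = 1 / f y y, or at
    large t when f y y vanishes. *)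
Lemma positive_form_CauchySchwarz x y :
  rnorm (f x y) ^+ 2 <= Re (f x x) * Re (f y y).
Proof.
have fyx := positive_form_herm x y.
have A0 := ge0_Re_ge0 (f_ge0 x); have B0 := ge0_Re_ge0 (f_ge0 y).
set A := Re (f x x) in A0 *; set B := Re (f y y) in B0 *.
have key t : 0 <= A - (2 * t - t ^+ 2 * B) * rnorm (f x y) ^+ 2.
  have := ge0_Re_ge0 (f_ge0 ((- (t%:C%C * f x y)) *: y + x)).
  rewrite !f_linl !f_linr fyx rnorm_sqr /A /B.
  have := f_ge0 y; case: (f y y) => b1 b2.
  rewrite lecE => /andP[/eqP/= ->] _.
  case: (f x x) => a1 a2; case: (f x y) => c1 c2 /=.
  by congr (0 <= _); ring.
have [B1|B1] := eqVneq B 0.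
  rewrite B1 mulr0; have [->//|c0] := eqVneq (rnorm (f x y) ^+ 2) 0.
  have := key ((A + 1) / 2 / rnorm (f x y) ^+ 2); rewrite B1 mulr0 subr0.
  by rewrite -mulrA mulfVK// mulrC divfK ?pnatr_eq0// opprD addNKr oppr_ge0 ler10.
have Bp : 0 < B by rewrite lt_def B1.
have := key B^-1.
have -> : A - (2 * B^-1 - B^-1 ^+ 2 * B) * rnorm (f x y) ^+ 2 =
  A - rnorm (f x y) ^+ 2 / B by field.
by rewrite subr_ge0 ler_pdivrMr.
Qed.

End positive_forms.

Section form_norm.
Context (R : realType) (V : lmodType R[i]) (dot : {dot V for Num.conj}).
Local Notation Re := complex.Re.
Implicit Types (x y : V) (a : R[i]) (t : R).

Lemma dotDl x y z : dot (x + y) z = dot x z + dot y z.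
Proof. exact: linearDl. Qed.
Lemma dotDr x y z : dot x (y + z) = dot x y + dot x z.
Proof. exact: linearDr. Qed.
Lemma dotBl x y z : dot (x - y) z = dot x z - dot y z.
Proof. exact: linearBl. Qed.
Lemma dotBr x y z : dot x (y - z) = dot x y - dot x z.
Proof. exact: linearBr. Qed.
Lemma dotZl a x y : dot (a *: x) y = a * dot x y.
Proof. by rewrite linearZl_LR. Qed.
Lemma dotZr a x y : dot x (a *: y) = a^* * dot x y.
Proof. by rewrite linearZr_LR. Qed.
Lemma dotC x y : dot y x = (dot x y)^*.
Proof. by rewrite hermC expr0 mul1r. Qed.
Lemma dot_suml (I : Type) (r : seq I) (P : pred I) (F : I -> V) x :
  dot (\sum_(i <- r | P i) F i) x = \sum_(i <- r | P i) dot (F i) x.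
Proof. exact: linear_sumlz. Qed.
Lemma dot_sumr (I : Type) (r : seq I) (P : pred I) (F : I -> V) x :
  dot x (\sum_(i <- r | P i) F i) = \sum_(i <- r | P i) dot x (F i).
Proof. exact: linear_sumr. Qed.

(** Convergence and completeness are expressed through the form alone, so that
    they apply to the sums and products of copies of K built below, which carry
    a form but no declared topology. *)
Definition fnorm x : R := Num.sqrt (Re (dot x x)).

Lemma fnorm_ge0 x : 0 <= fnorm x.
Proof. exact: sqrtr_ge0. Qed.

Lemma fnorm_sqr x : fnorm x ^+ 2 = Re (dot x x).
Proof. by rewrite sqr_sqrtr// ge0_Re_ge0// dnorm_ge0. Qed.

Lemma dotxx x : dot x x = (fnorm x ^+ 2)%:C%C.
Proof. by rewrite fnorm_sqr -ge0_ReK// dnorm_ge0. Qed.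

Lemma fnorm0 : fnorm 0 = 0.
Proof. by rewrite /fnorm linear0r sqrtr0. Qed.

Lemma fnorm0_eq0 x : fnorm x = 0 -> x = 0.
Proof.
by move=> x0; apply/eqP; rewrite -(dnorm_eq0 dot) dotxx x0 expr0n.
Qed.

Lemma fnormZ a x : fnorm (a *: x) = rnorm a * fnorm x.
Proof.
apply/eqP; rewrite -(@eqrXn2 _ 2) ?mulr_ge0 ?fnorm_ge0 ?rnorm_ge0//.
rewrite exprMn !fnorm_sqr dotZl dotZr mulrA -normCK -rnormE -rmorphXn/=.
by rewrite Re_realM.
Qed.

Lemma fnormN x : fnorm (- x) = fnorm x.
Proof. by rewrite -scaleN1r fnormZ rnormN /rnorm normr1 mul1r. Qed.

Lemma fnormBC x y : fnorm (x - y) = fnorm (y - x).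
Proof. by rewrite -fnormN opprB. Qed.

Lemma CauchySchwarz_dot x y : rnorm (dot x y) <= fnorm x * fnorm y.
Proof.
rewrite -(@ler_pXn2r _ 2) ?nnegrE ?mulr_ge0 ?fnorm_ge0 ?rnorm_ge0//.
rewrite exprMn !fnorm_sqr; apply: positive_form_CauchySchwarz.
- by move=> z a u v; rewrite dotDl dotZl.
- by move=> z a u v; rewrite dotDr dotZr.
- by move=> z; exact: dnorm_ge0.
Qed.

Lemma fnormD_sqr x y :
  fnorm (x + y) ^+ 2 = fnorm x ^+ 2 + fnorm y ^+ 2 + 2 * Re (dot x y).
Proof.
rewrite !fnorm_sqr dotDl !dotDr !Re_add (dotC x y).
have -> : Re (dot x y)^* = Re (dot x y) by case: (dot x y).
ring.
Qed.

Lemma fnormB_sqr x y :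
  fnorm (x - y) ^+ 2 = fnorm x ^+ 2 + fnorm y ^+ 2 - 2 * Re (dot x y).
Proof.
by rewrite fnormD_sqr fnormN -scaleN1r dotZr rmorphN rmorph1 mulN1r Re_opp mulrN.
Qed.

Lemma fnormD x y : fnorm (x + y) <= fnorm x + fnorm y.
Proof.
rewrite -(@ler_pXn2r _ 2) ?nnegrE ?addr_ge0 ?fnorm_ge0//.
rewrite fnormD_sqr sqrrD.
have := le_trans (Re_le_rnorm _) (CauchySchwarz_dot x y).
rewrite -mulr_natl; lra.
Qed.

Lemma fnormB_le x y z : fnorm (x - z) <= fnorm (x - y) + fnorm (y - z).
Proof. by rewrite -[x - z](subrKA y) fnormD. Qed.

Lemma fnorm_sub_ge x y : fnorm x - fnorm y <= fnorm (x - y).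
Proof. by rewrite lerBlDr -{1}[x](subrK y) fnormD. Qed.

Lemma dot_eq0l x : (forall y, dot y x = 0) -> x = 0.
Proof. by move=> /(_ x) /eqP; rewrite dnorm_eq0 => /eqP. Qed.

Definition form_cvg (u : nat -> V) (l : V) : Prop :=
  (fun n => fnorm (u n - l)) @ \oo --> (0 : R).

Definition form_cauchy (u : nat -> V) : Prop :=
  forall e : R, 0 < e -> exists N, forall m n, (N <= m)%N -> (N <= n)%N ->
    fnorm (u m - u n) < e.

Definition form_complete : Prop :=
  forall u, form_cauchy u -> exists l, form_cvg u l.

Lemma form_cvg_cst x : form_cvg (fun=> x) x.
Proof. by rewrite /form_cvg; under eq_fun do rewrite subrr fnorm0; exact: cvg_cst. Qed.

Lemma form_cvg_linear a u v x y : form_cvg u x -> form_cvg v y ->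
  form_cvg (fun n => a *: u n + v n) (a *: x + y).
Proof.
move=> ux vy; apply: (@squeeze0 _ _ (fun n =>
    rnorm a * fnorm (u n - x) + fnorm (v n - y))).
  move=> n; rewrite fnorm_ge0/= -fnormZ.
  by rewrite (_ : _ - _ = a *: (u n - x) + (v n - y)) ?fnormD// scalerBr opprD addrACA.
rewrite -(addr0 (0 : R)); apply: cvgD => //.
by rewrite -(mulr0 (rnorm a)); exact: cvgMr.
Qed.

Lemma form_cvgD u v x y : form_cvg u x -> form_cvg v y ->
  form_cvg (fun n => u n + v n) (x + y).
Proof.
move=> ux vy; have := form_cvg_linear 1 ux vy.
by rewrite scale1r; under eq_fun do rewrite scale1r.
Qed.

Lemma form_cvgZ a u x : form_cvg u x -> form_cvg (fun n => a *: u n) (a *: x).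
Proof.
move=> ux; have := form_cvg_linear a ux (form_cvg_cst 0).
by rewrite addr0; under eq_fun do rewrite addr0.
Qed.

Lemma form_cvgB u v x y : form_cvg u x -> form_cvg v y ->
  form_cvg (fun n => u n - v n) (x - y).
Proof.
move=> ux vy; have := form_cvg_linear (-1) vy ux.
rewrite scaleN1r addrC; under eq_fun do rewrite scaleN1r addrC; exact.
Qed.

Lemma form_cvg_unique u x y : form_cvg u x -> form_cvg u y -> x = y.
Proof.
move=> ux uy; apply/eqP; rewrite -subr_eq0; apply/eqP/fnorm0_eq0.
have := form_cvgB ux uy; rewrite /form_cvg.
under eq_fun do rewrite subrr sub0r fnormN.
by move=> h; apply: (@cvg_unique _ (@Rhausdorff R) _ _ _ _ _ h); exact: cvg_cst.
Qed.

Lemma form_cvg_fnorm u x : form_cvg u x -> (fun n => fnorm (u n)) @ \oo --> fnorm x.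
Proof.
move=> ux; apply/cvgrPdist_le => e e0.
move/cvgrPdist_le : ux => /(_ e e0); apply: filterS => n /=.
rewrite sub0r normrN ger0_norm ?fnorm_ge0// => h.
rewrite ler_norml; have := fnorm_sub_ge (u n) x; have := fnorm_sub_ge x (u n).
by rewrite fnormBC => h1 h2; apply/andP; split; lra.
Qed.

Lemma form_cvg_dot u x y : form_cvg u x ->
  (fun n => rnorm (dot (u n) y - dot x y)) @ \oo --> (0 : R).
Proof.
move=> ux; apply: (@squeeze0 _ _ (fun n => fnorm (u n - x) * fnorm y)).
  by move=> n; rewrite rnorm_ge0/= -dotBl CauchySchwarz_dot.
by rewrite -(mul0r (fnorm y)); apply: cvgMl.
Qed.

Lemma form_cvg_dot_eq u x y c : form_cvg u x -> (forall n, dot (u n) y = c) ->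
  dot x y = c.
Proof.
move=> /form_cvg_dot - /(_ y) h uc; apply/eqP; rewrite eq_sym -subr_eq0; apply/eqP.
apply: rnorm0_eq0; apply: (@cvg_unique _ (@Rhausdorff R) _ _ _ _ _ h).
rewrite (_ : (fun n => _) = fun=> rnorm (c - dot x y)); first exact: cvg_cst.
by apply/funext => n; rewrite uc.
Qed.

Lemma form_cvg_cauchy u x : form_cvg u x -> form_cauchy u.
Proof.
move=> /cvgrPdist_lt ux e e0; have [N _ h] := ux _ (divr_gt0 e0 (ltr0Sn _ 1)).
exists N => m n /h/= hm /h/= hn; apply: le_lt_trans (fnormB_le _ x _) _.
rewrite sub0r normrN ger0_norm ?fnorm_ge0// in hm.
rewrite sub0r normrN ger0_norm ?fnorm_ge0// in hn.
rewrite (fnormBC x); lra.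
Qed.

(** The common reason for which the iterations below converge: the increments
    are bounded by those of a convergent real sequence, and so telescope. *)
Lemma cauchy_dominated u (b : R^nat) : form_complete -> cvgn b ->
  (forall n, fnorm (u n.+1 - u n) <= b n.+1 - b n) -> exists l, form_cvg u l.
Proof.
move=> Vc cb ub; apply: Vc => e e0.
have ubd m d : fnorm (u (m + d)%N - u m) <= b (m + d)%N - b m.
  elim: d => [|d IH]; first by rewrite addn0 !subrr fnorm0.
  rewrite addnS (le_trans (fnormB_le _ (u (m + d)%N) _))//.
  by have := ub (m + d)%N; lra.
move/cvgrPdist_lt : (cb) => /(_ _ (divr_gt0 e0 (ltr0Sn _ 1)))[N _ h].
exists N; suff H m n : (N <= m)%N -> (m <= n)%N -> fnorm (u n - u m) < e.
  move=> m n Nm Nn; have [mn|/ltnW nm] := leqP m n; first by rewrite fnormBC H.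
  exact: H.
move=> Nm mn; have := ubd m (n - m)%N; rewrite subnKC// => /le_lt_trans; apply.
have /= := h m Nm; have /= := h n (leq_trans Nm mn).
by rewrite !ltr_norml => /andP[? ?] /andP[? ?]; lra.
Qed.

End form_norm.

(** * Riesz representation on the closure of a range *)

Section raw_linear.
Context (R : nzRingType) (U V : lmodType R) (f : U -> V).
Hypothesis lf : linear f.

Lemma raw_linear0 : f 0 = 0.
Proof. by have := lf (-1) 0 0; rewrite scaler0 addr0 scaleN1r addNr. Qed.

Lemma raw_linearZ a x : f (a *: x) = a *: f x.
Proof. by have := lf a x 0; rewrite raw_linear0 !addr0. Qed.

Lemma raw_linearD x y : f (x + y) = f x + f y.
Proof. by have := lf 1 x y; rewrite !scale1r. Qed.

Lemma raw_linearB x y : f (x - y) = f x - f y.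
Proof. by rewrite addrC -scaleN1r lf scaleN1r addrC. Qed.

Lemma raw_linear_sum (I : Type) (r : seq I) (P : pred I) (F : I -> U) :
  f (\sum_(i <- r | P i) F i) = \sum_(i <- r | P i) f (F i).
Proof. exact: (big_morph f raw_linearD raw_linear0). Qed.

End raw_linear.

Section range_riesz.
Context (R : realType) (X V : lmodType R[i]) (dot : {dot V for Num.conj}).
Hypothesis V_complete : form_complete dot.
Context (T : X -> V) (T_linear : linear T).
Local Notation Re := complex.Re.
Local Notation Im := complex.Im.
Local Notation norm := (fnorm dot).

Lemma parallelogram (x y : V) :
  norm (x - y) ^+ 2 = 2 * norm x ^+ 2 + 2 * norm y ^+ 2 - norm (x + y) ^+ 2.
Proof. by rewrite fnormB_sqr fnormD_sqr; ring. Qed.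

(** Minimize |T x|^2 - 2 Re (phi x), which is bounded below by - M^2.  By the
    parallelogram law the images of a minimizing sequence form a Cauchy
    sequence, and the vanishing first variation at the limit p is the equation
    phi x = <T x, p>.  With T the identity this is the Riesz theorem; with
    phi x = <T x, y> it is the orthogonal projection onto the closure of the
    range of T. *)
Lemma range_riesz (phi : X -> R[i]) (M : R) :
  (forall a x y, phi (a *: x + y) = a * phi x + phi y) ->
  (forall x, rnorm (phi x) <= M * norm (T x)) ->
  exists u : nat -> X, exists p : V,
    form_cvg dot (T \o u) p /\ forall x, phi x = dot (T x) p.
Proof.
move=> phi_linear phi_le.
pose E x := norm (T x) ^+ 2 - 2 * Re (phi x).
have phiD x y : phi (x + y) = phi x + phi y.
  by have := phi_linear 1 x y; rewrite scale1r mul1r.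
have phi0 : phi 0 = 0.
  by have := phi_linear (-1) 0 0; rewrite scaler0 addr0 mulN1r addNr.
have phiZ a x : phi (a *: x) = a * phi x.
  by have := phi_linear a x 0; rewrite !addr0 phi0 addr0.
have E_ge x : - M ^+ 2 <= E x.
  have := le_trans (Re_le_rnorm _) (phi_le x).
  have := sqr_ge0 (norm (T x) - M); rewrite /E sqrrB -mulr_natl.
  by lra.
have E_inf : has_inf (range E).
  by split; [exists (E 0); exists 0|exists (- M ^+ 2) => _ [x _ <-]].
have inf_le x : inf (range E) <= E x by apply: ge_inf; [exact: E_inf.2|exists x].
have /choice [u u_min] : forall n, exists x, E x < inf (range E) + n.+1%:R^-1.
  move=> n; have n0 : 0 < n.+1%:R^-1 :> R by rewrite invr_gt0.
  by have [_ [x _ <-] h] := inf_adherent n0 E_inf; exists x.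
have u_cauchy : form_cauchy dot (T \o u).
  move=> e e0; have e40 : 0 < e ^+ 2 / 4 by rewrite divr_gt0 ?exprn_gt0.
  have [N _ hN] := near_infty_natSinv_lt (PosNum e40).
  exists N => m n /hN/= hm /hN/= hn.
  rewrite -(@ltr_pXn2r _ 2) ?nnegrE ?fnorm_ge0 ?(ltW e0)//.
  rewrite parallelogram.
  (* the midpoint of two near-minimizers cannot go below the infimum *)
  have := inf_le (2^-1 *: (u m + u n)).
  rewrite /E (raw_linearZ T_linear) (raw_linearD T_linear) phiZ phiD.
  have -> : (2^-1 : R[i]) = (2^-1 : R)%:C%C by rewrite fmorphV/= rmorphMn/=.
  rewrite fnormZ rnorm_real ger0_norm ?invr_ge0// exprMn Re_realM Re_add.
  have := u_min m; have := u_min n; rewrite /E.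
  set I := inf _; set a := norm (T (u m)) ^+ 2; set b := norm (T (u n)) ^+ 2.
  set c := norm _ ^+ 2; rewrite [2^-1 ^+ 2](_ : _ = 4^-1); last by field.
  have {}hm : m.+1%:R^-1 < e ^+ 2 / 4 :> R := hm.
  have {}hn : n.+1%:R^-1 < e ^+ 2 / 4 :> R := hn.
  move: (m.+1%:R^-1) (n.+1%:R^-1) hm hn => p q.
  by lra.
have [p up] := V_complete u_cauchy; exists u, p; split=> // x.
suff H y : Re (phi y) = Re (dot (T y) p).
  have := H x; have := H ('i%C *: x); rewrite phiZ (raw_linearZ T_linear) dotZl.
  case: (phi x) => a b; case: (dot _ _) => c d /=.
  by rewrite !mul0r !mul1r !sub0r => /oppr_inj -> ->.
pose D n := Re (dot (T (u n)) (T y)) - Re (phi y).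
have cD : D @ \oo --> Re (dot p (T y)) - Re (phi y).
  apply: cvgB; last exact: cvg_cst.
  apply/cvgrPdist_le => e e0.
  move/cvgrPdist_le : (form_cvg_dot (T y) up) => /(_ e e0).
  apply: filterS => n /=.
  rewrite sub0r normrN ger0_norm ?rnorm_ge0//; apply: le_trans.
  rewrite distrC -[X in _ <= X]ger0_norm ?rnorm_ge0// -rnorm_real.
  rewrite rnorm_real -Re_opp -Re_add ger0_norm ?rnorm_ge0//.
  by rewrite -lecR rnormE normc_ge_Re.
rewrite (dotC dot p (T y)); have -> : Re (dot p (T y))^* = Re (dot p (T y)).
  by case: (dot _ _).
move: (Re (dot p _)) cD => d cD.
(* variation of the minimizing sequence in the direction t y, at the limit *)
have key t : 0 <= 2 * t * (d - Re (phi y)) + t ^+ 2 * norm (T y) ^+ 2.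
  have c1 : (fun n => 2 * t * D n + t ^+ 2 * norm (T y) ^+ 2) @ \oo -->
    2 * t * (d - Re (phi y)) + t ^+ 2 * norm (T y) ^+ 2.
    by apply: cvgD; [exact: cvgMr|exact: cvg_cst].
  have c2 : (fun n : nat => - n.+1%:R^-1 : R) @ \oo --> (- 0 : R).
    by apply: cvgN; exact: cvg_harmonic.
  rewrite -oppr0; apply: (ler_cvg_to c2 c1); near=> n.
  have := inf_le (t%:C%C *: y + u n); have := u_min n.
  rewrite /E T_linear phi_linear fnormD_sqr fnormZ rnorm_real exprMn.
  rewrite real_normK ?num_real// dotZl Re_add !Re_realM (dotC dot (T (u n))).
  have -> : Re (dot (T (u n)) (T y))^* = Re (dot (T (u n)) (T y)).
    by case: (dot _ _).
  rewrite /D; move: (n.+1%:R^-1) => q; lra.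
apply/eqP; rewrite eq_sym -subr_eq0; move: (d - _) key => {cD}{}d key.
set b := norm (T y) ^+ 2 in key; have b0 : 0 <= b by rewrite sqr_ge0.
have b1 : b + 1 != 0 by rewrite gt_eqF// ltr_wpDl.
have := key (- d / (b + 1)).
rewrite (_ : _ + _ = - ((b + 2) / (b + 1) ^+ 2 * d ^+ 2)); last by field.
rewrite oppr_ge0 pmulr_rle0; last by rewrite divr_gt0 ?exprn_gt0// ltr_wpDl.
by move=> dd; rewrite -sqrf_eq0 eq_le dd sqr_ge0.
Unshelve. all: by end_near. Qed.

(** P is the orthogonal projector onto the closure of the range of T, given
    together with a chosen sequence s x of preimages with T (s x n) --> P x.  One
    such choice serves every operator that is extended from the range, so the
    extensions inherit the linear dependence of those operators on parameters. *)
Definition range_projector (s : V -> nat -> X) (P : V -> V) : Prop :=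
  (forall x, form_cvg dot (T \o s x) (P x)) /\
  forall x y, dot (T y) (P x) = dot (T y) x.

Lemma range_projector_exists : exists s P, range_projector s P.
Proof.
have h x : exists up : (nat -> X) * V, form_cvg dot (T \o up.1) up.2 /\
    forall y, dot (T y) x = dot (T y) up.2.
  have [||u [p [up pE]]] := @range_riesz (fun y => dot (T y) x) (norm x).
  - by move=> a y z; rewrite T_linear dotDl dotZl.
  - by move=> y; rewrite mulrC CauchySchwarz_dot.
  by exists (u, p).
have [sP sPE] := choice h.
exists (fst \o sP), (snd \o sP); split=> x /=; first exact: (sPE x).1.
by move=> y; rewrite (sPE x).2.
Qed.

(** This is what makes the chosen preimages behave linearly: the sequences
    chosen for a *: x + y and combined from those for x and y have images whose
    difference is a limit in the closure of the range and orthogonal to it. *)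
Lemma range_closure_orth (u : nat -> X) p :
  form_cvg dot (T \o u) p -> (forall y, dot (T y) p = 0) -> p = 0.
Proof.
move=> up p0; apply/eqP; rewrite -(dnorm_eq0 dot); apply/eqP.
by apply: (form_cvg_dot_eq up) => n; exact: p0.
Qed.

Context (s : V -> nat -> X) (P : V -> V) (sP : range_projector s P).

Lemma range_projector_linear : linear P.
Proof.
move=> a x y; apply/eqP; rewrite -subr_eq0; apply/eqP.
apply: (@range_closure_orth (fun n => s (a *: x + y) n - (a *: s x n + s y n))).
  have h := form_cvgB (sP.1 (a *: x + y)) (form_cvg_linear a (sP.1 x) (sP.1 y)).
  by rewrite /comp /=; under eq_fun do rewrite raw_linearB// T_linear.
by move=> z; rewrite dotBr dotDr dotZr !sP.2 dotDr dotZr subrr.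
Qed.

Lemma range_projector_dot x y : dot (P x) (T y) = dot x (T y).
Proof. by rewrite dotC sP.2 -dotC. Qed.

Lemma range_projector_le x : norm (P x) <= norm x.
Proof.
have h : dot (P x) (P x) = dot (P x) x.
  apply/eqP; rewrite -subr_eq0 -dotBr; apply/eqP.
  by apply: (form_cvg_dot_eq (sP.1 x)) => n; rewrite dotBr sP.2 subrr.
have := CauchySchwarz_dot dot (P x) x; rewrite -h dotxx rnorm_real.
rewrite ger0_norm ?sqr_ge0//.
have := fnorm_ge0 dot (P x); rewrite le_eqVlt => /predU1P[<- _|P0].
  exact: fnorm_ge0.
by rewrite expr2 ler_pM2l.
Qed.

(** The map T x |-> S x is well defined and bounded on the range of T by the
    domination hypothesis; Q is its continuous extension to the closure composed
    with P, hence zero on the orthogonal complement. *)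
Lemma range_extension (W : lmodType R[i]) (dotW : {dot W for Num.conj})
    (S : X -> W) (c : R) : form_complete dotW -> linear S -> 0 <= c ->
    (forall x, fnorm dotW (S x) <= c * norm (T x)) ->
  exists2 Q : V -> W, forall x, form_cvg dotW (S \o s x) (Q x) &
    linear Q /\ forall x, fnorm dotW (Q x) <= c * norm x.
Proof.
move=> Wc S_linear c0 S_le.
have /choice[Q QE] : forall x, exists y, form_cvg dotW (S \o s x) y.
  move=> x; apply: Wc => e e0.
  have e1 : 0 < e / (c + 1) by rewrite divr_gt0// ltr_wpDl.
  have [N h] := form_cvg_cauchy (sP.1 x) e1.
  exists N => m n Nm Nn /=; rewrite -raw_linearB//.
  apply: le_lt_trans (S_le _) _; have := h m n Nm Nn; rewrite /= -raw_linearB//.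
  have c1 : 0 < c + 1 by rewrite ltr_wpDl.
  rewrite ltr_pdivlMr// => /(le_lt_trans _); apply.
  by rewrite mulrC ler_wpM2l ?fnorm_ge0// lerDl.
exists Q => //; split.
  move=> a x y; apply: (form_cvg_unique (QE (a *: x + y))).
  have h := form_cvg_linear a (QE x) (QE y).
  have PE := form_cvgB (sP.1 (a *: x + y)) (form_cvg_linear a (sP.1 x) (sP.1 y)).
  rewrite range_projector_linear subrr in PE.
  have SE : form_cvg dotW (fun n => S (s (a *: x + y) n - (a *: s x n + s y n))) 0.
    apply: (@squeeze0 _ _ (fun n =>
      c * norm (T (s (a *: x + y) n - (a *: s x n + s y n))))).
      by move=> n; rewrite fnorm_ge0 subr0 S_le.
    rewrite -(mulr0 c); apply: cvgMr; move: PE; rewrite /form_cvg.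
    under eq_fun do rewrite subr0 /= -T_linear -raw_linearB//.
    exact.
  have := form_cvgD SE h; rewrite add0r.
  under eq_fun do rewrite /= raw_linearB// S_linear subrK.
  exact.
move=> x; apply: le_trans (ler_wpM2l c0 (range_projector_le x)).
have cP : (fun n => c * norm (T (s x n))) @ \oo --> c * norm (P x).
  by apply: cvgMr; exact: (form_cvg_fnorm (sP.1 x)).
apply: (ler_cvg_to (form_cvg_fnorm (QE x)) cP).
by near=> n; exact: S_le.
Unshelve. all: by end_near. Qed.

End range_riesz.

Section adjoints.
Context (R : realType) (V W : lmodType R[i]).
Context (dotV : {dot V for Num.conj}) (dotW : {dot W for Num.conj}).

(** The vector g y represents the bounded functional x |-> <f x, y>. *)
Lemma bounded_adjoint (f : V -> W) (M : R) : form_complete dotV -> linear f ->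
    0 <= M ->
    (forall x, fnorm dotW (f x) <= M * fnorm dotV x) ->
  exists g : W -> V, [/\ linear g, forall x y, dotW (f x) y = dotV x (g y) &
    forall y, fnorm dotV (g y) <= M * fnorm dotW y].
Proof.
move=> Vc f_linear M0 f_le.
have /choice[g gE] y : exists z, forall x, dotW (f x) y = dotV x z.
  have [//|||u [p [_ pE]]] := @range_riesz _ _ _ dotV Vc idfun _
      (fun x => dotW (f x) y) (M * fnorm dotW y).
  - by move=> a x z; rewrite f_linear dotDl dotZl.
  - move=> x; apply: le_trans (CauchySchwarz_dot _ _ _) _.
    by rewrite mulrAC ler_wpM2r ?fnorm_ge0.
  by exists p.
exists g; split=> //.
  move=> a x y; apply/eqP; rewrite -subr_eq0; apply/eqP/(@dot_eq0l _ _ dotV) => z.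
  by rewrite dotBr dotDr dotZr -!gE dotDr dotZr subrr.
move=> y; have := CauchySchwarz_dot dotW (f (g y)) y.
rewrite gE dotxx rnorm_real ger0_norm ?sqr_ge0// => h.
have := fnorm_ge0 dotV (g y); rewrite le_eqVlt => /predU1P[g0|g0].
  by rewrite -g0 mulr_ge0 ?fnorm_ge0.
rewrite -(ler_pM2l g0) -expr2 (le_trans h)//.
by rewrite mulrA [X in _ <= X * _]mulrC ler_wpM2r ?fnorm_ge0.
Qed.

End adjoints.

(** * Direct sums, square roots and Neumann series *)

Section direct_sum.
Context (R : realType) (I : finType) (V : lmodType R[i]).
Context (dot : {dot V for Num.conj}).
Local Notation Re := complex.Re.

Definition sum_dot (x y : I -> V) : R[i] := \sum_i dot (x i) (y i).

Lemma sum_dot_bilinear :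
  bilinear_for ( *%R) (Num.conj \; *%R) sum_dot.
Proof.
split=> [y a u v|x a u v]; rewrite /sum_dot /= mulr_sumr -big_split/=;
  apply: eq_bigr => i _.
  by rewrite !fctE dotDl dotZl.
by rewrite !fctE dotDr dotZr.
Qed.

HB.instance Definition _ := bilinear_isBilinear.Build R[i] (I -> V) (I -> V)
  R[i] ( *%R) (Num.conj \; *%R) sum_dot sum_dot_bilinear.

Lemma sum_dot_herm x y : sum_dot x y = (-1) ^+ false * (sum_dot y x)^*.
Proof.
by rewrite expr0 mul1r rmorph_sum; apply: eq_bigr => i _; exact: dotC.
Qed.

HB.instance Definition _ := isHermitianSesquilinear.Build R[i] (I -> V) false
  Num.conj sum_dot sum_dot_herm.

Lemma sum_dot_gt0 x : x != 0 -> 0 < sum_dot x x.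
Proof.
move=> x0; rewrite lt_def sumr_ge0 => [|i _]; last exact: dnorm_ge0.
rewrite andbT; apply: contra_neq x0 => s0; apply/funext => i.
have /allP /(_ i (mem_index_enum i)) :
    all (fun i => true ==> (dot (x i) (x i) == 0)) (index_enum I).
  by rewrite -psumr_eq0 => [|j _]; [exact/eqP|exact: dnorm_ge0].
by rewrite /= dnorm_eq0 => /eqP.
Qed.

HB.instance Definition _ := isDotProduct.Build R[i] (I -> V) sum_dot sum_dot_gt0.

Lemma fnorm_sum_dot (x : I -> V) :
  fnorm sum_dot x ^+ 2 = \sum_i fnorm dot (x i) ^+ 2.
Proof.
by rewrite fnorm_sqr Re_sum; apply: eq_bigr => i _; rewrite fnorm_sqr.
Qed.

Lemma fnorm_le_sum_dot (x : I -> V) i : fnorm dot (x i) <= fnorm sum_dot x.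
Proof.
rewrite -(@ler_pXn2r _ 2) ?nnegrE ?fnorm_ge0// fnorm_sum_dot (bigD1 i)//= lerDl.
by apply: sumr_ge0 => j _; rewrite sqr_ge0.
Qed.

Lemma fnorm_sum_dot_le (x : I -> V) : fnorm sum_dot x <= \sum_i fnorm dot (x i).
Proof.
have s0 (r : seq I) : 0 <= \sum_(i <- r) fnorm dot (x i).
  by apply: sumr_ge0 => j _; rewrite fnorm_ge0.
rewrite -(@ler_pXn2r _ 2) ?nnegrE ?fnorm_ge0// fnorm_sum_dot.
elim: (index_enum I) => [|i r IH]; first by rewrite !big_nil expr0n.
rewrite !big_cons sqrrD; apply: lerD => //.
by rewrite lerDl mulrn_wge0// mulr_ge0 ?fnorm_ge0.
Qed.

Lemma form_cvg_sum_dot (u : nat -> I -> V) (l : I -> V) :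
  (forall i, form_cvg dot (u^~ i) (l i)) -> form_cvg sum_dot u l.
Proof.
move=> ul; apply: (@squeeze0 _ _ (fun n => \sum_i fnorm dot (u n i - l i))).
  by move=> n; rewrite fnorm_ge0 fnorm_sum_dot_le.
elim: (index_enum I) => [|i r IH].
  by under eq_fun do rewrite big_nil; exact: cvg_cst.
under eq_fun do rewrite big_cons.
by have := cvgD (ul i) IH; rewrite addr0; exact.
Qed.

Lemma sum_dot_complete : form_complete dot -> form_complete sum_dot.
Proof.
move=> Vc u uc; have /choice[l ul] i : exists l, form_cvg dot (u^~ i) l.
  apply: Vc => e /uc[N h]; exists N => m n Nm Nn.
  exact: le_lt_trans (fnorm_le_sum_dot (u m - u n) i) (h _ _ Nm Nn).
by exists l; exact: form_cvg_sum_dot.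
Qed.

End direct_sum.

Section positive_root.
Context (R : realType) (V : lmodType R[i]) (dot : {dot V for Num.conj}).
Hypothesis V_complete : form_complete dot.
Local Notation Re := complex.Re.
Local Notation fnorm := (fnorm dot).

Section positive_contraction.
Context (A : V -> V) (A_linear : linear A).
Hypothesis A_ge0 : forall x, 0 <= dot (A x) x.

Lemma positive_selfadjoint x y : dot (A x) y = dot x (A y).
Proof.
rewrite (dotC dot (A y)); apply: (positive_form_herm (f := fun x y => dot (A x) y)).
- by move=> z a u v; rewrite A_linear dotDl dotZl.
- by move=> z a u v; rewrite dotDr dotZr.
- exact: A_ge0.
Qed.

Hypothesis A_le1 : forall x, Re (dot (A x) x) <= fnorm x ^+ 2.

(** Apply the Cauchy-Schwarz inequality of the form <A x, y> to x and A x, and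
    bound both diagonal values by squared norms. *)
Lemma positive_contraction x : fnorm (A x) <= fnorm x.
Proof.
have CS : rnorm (dot (A x) (A x)) ^+ 2 <= Re (dot (A x) x) * Re (dot (A (A x)) (A x)).
  apply: (positive_form_CauchySchwarz (f := fun x y => dot (A x) y)).
  - by move=> z a u v; rewrite A_linear dotDl dotZl.
  - by move=> z a u v; rewrite dotDr dotZr.
  - exact: A_ge0.
rewrite dotxx rnorm_real ger0_norm ?sqr_ge0// in CS.
have := le_trans CS (ler_pM (ge0_Re_ge0 (A_ge0 _)) (ge0_Re_ge0 (A_ge0 _))
  (A_le1 _) (A_le1 _)).
rewrite -exprMn ler_pXn2r ?nnegrE ?mulr_ge0 ?fnorm_ge0 ?sqr_ge0// expr2.
have := fnorm_ge0 dot (A x); rewrite le_eqVlt => /predU1P[<- _|P0].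
  exact: fnorm_ge0.
by rewrite ler_pM2r.
Qed.

(** For 0 <= A <= 1 the square root of 1 - A is 1 - Y, where
    2 Y = A + Y^2; the iteration for Y starts at 0.  The scalar iteration
    [root_bound] is the case A = 1. *)
Fixpoint root_iter n (x : V) : V :=
  if n is m.+1 then 2^-1 *: (A x + root_iter m (root_iter m x)) else 0.

Fixpoint root_bound n : R :=
  if n is m.+1 then (1 + root_bound m ^+ 2) / 2 else 0.

Lemma root_bound_itv n : 0 <= root_bound n <= 1.
Proof.
elim: n => [|n /andP[h0 h1]] /=; first by rewrite lexx ler01.
have : root_bound n ^+ 2 <= 1 by rewrite expr_le1.
by have := sqr_ge0 (root_bound n); lra.
Qed.

Lemma root_bound_le n : root_bound n <= root_bound n.+1.
Proof.
have /andP[h0 h1] := root_bound_itv n.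
have := sqr_ge0 (1 - root_bound n); rewrite /= sqrrB expr1n mul1r -mulr_natl; lra.
Qed.

Lemma root_bound_cvg : cvgn root_bound.
Proof.
apply: nondecreasing_is_cvgn.
  by apply/nondecreasing_seqP; exact: root_bound_le.
by exists 1 => _ [n _ <-]; have /andP[] := root_bound_itv n.
Qed.

Lemma root_iter_linear n : linear (root_iter n).
Proof.
elim: n => [|n IH] a x y /=; first by rewrite scaler0 addr0.
rewrite A_linear !IH scalerA mulrC -scalerA -scalerDr; congr (_ *: _).
by rewrite scalerDr addrACA.
Qed.

Lemma rnorm_half : rnorm (2^-1 : R[i]) = 2^-1.
Proof.
have -> : (2^-1 : R[i]) = (2^-1 : R)%:C%C by rewrite fmorphV/= rmorphMn/=.
by rewrite rnorm_real ger0_norm ?invr_ge0.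
Qed.

Lemma root_iter_le n x : fnorm (root_iter n x) <= root_bound n * fnorm x.
Proof.
elim: n x => [|n IH] x /=; first by rewrite fnorm0 mul0r.
rewrite fnormZ rnorm_half mulrC mulrAC ler_wpM2r ?invr_ge0//.
rewrite (le_trans (fnormD _ _ _))// mulrDl mul1r lerD ?positive_contraction//.
rewrite (le_trans (IH _))// expr2 -mulrA ler_wpM2l//.
by have /andP[] := root_bound_itv n.
Qed.

(** Factor Y^2 - Z^2 as Y (Y - Z) + (Y - Z) Z: the operator increments are
    dominated by the scalar ones, which have a convergent sum.  Convergence thus
    holds in norm, without the monotone convergence theorem for operators. *)
Lemma root_iter_step n x : fnorm (root_iter n.+1 x - root_iter n x) <=
  (root_bound n.+1 - root_bound n) * fnorm x.
Proof.
elim: n x => [|n IH] x.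
  by rewrite !subr0; have := root_iter_le 1 x.
rewrite [root_iter n.+2 _]/= [X in _ - X]/= -scalerBr fnormZ rnorm_half.
rewrite opprD addrACA subrr add0r.
have -> : root_bound n.+2 - root_bound n.+1 =
    2^-1 * (root_bound n.+1 ^+ 2 - root_bound n ^+ 2).
  have bS k : root_bound k.+1 = (1 + root_bound k ^+ 2) / 2 by [].
  by rewrite bS [X in _ - X = _]bS; field.
rewrite -[X in _ <= X]mulrA ler_wpM2l ?invr_ge0// subr_sqr mulrDr mulrDl.
set Y := root_iter n.+1; set Z := root_iter n.
set b := root_bound n.+1; set c := root_bound n.
have -> : Y (Y x) - Z (Z x) = Y (Y x - Z x) + (Y (Z x) - Z (Z x)).
  by rewrite /Y (raw_linearB (root_iter_linear n.+1)) subrKA.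
have /andP[b0 _] := root_bound_itv n.+1; have /andP[c0 _] := root_bound_itv n.
have bc : 0 <= b - c by rewrite subr_ge0 root_bound_le.
apply: le_trans (fnormD _ _ _) _; apply: lerD.
  apply: le_trans (root_iter_le _ _) _; rewrite -/b.
  rewrite (_ : (b - c) * b * fnorm x = b * ((b - c) * fnorm x)); last by ring.
  by rewrite ler_wpM2l// IH.
apply: le_trans (IH _) _; rewrite -mulrA ler_wpM2l//.
exact: root_iter_le.
Qed.

Lemma root_iter_selfadjoint n x y : dot (root_iter n x) y = dot x (root_iter n y).
Proof.
elim: n x y => [|n IH] x y /=; first by rewrite linear0l linear0r.
rewrite dotZl dotZr dotDl dotDr !IH positive_selfadjoint; congr (_ * _).
by rewrite fmorphV rmorph_nat.
Qed.

Lemma root_fixpoint : exists Y : V -> V, [/\ linear Y,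
  forall x y, dot (Y x) y = dot x (Y y) & forall x, Y x = 2^-1 *: (A x + Y (Y x))].
Proof.
have /choice[Y YE] x : exists y, form_cvg dot (fun n => root_iter n x) y.
  apply: (cauchy_dominated (b := fun n => root_bound n * fnorm x)) => //.
    by apply: is_cvgMl; exact: root_bound_cvg.
  by move=> n; rewrite -mulrBl root_iter_step.
exists Y; split.
- move=> a x y; apply: (form_cvg_unique (YE (a *: x + y))).
  under eq_fun do rewrite root_iter_linear.
  exact: form_cvg_linear.
- move=> x y; apply/eqP; rewrite -subr_eq0; apply/eqP/rnorm0_eq0.
  have h1 := form_cvg_dot y (YE x); have h2 := form_cvg_dot x (YE y).
  have h : (fun n => rnorm (dot (Y x) y - dot x (Y y)) : R) @ \oo --> (0 : R).
    apply: (@squeeze0 _ _ (fun n => rnorm (dot (root_iter n x) y - dot (Y x) y) +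
        rnorm (dot (root_iter n y) x - dot (Y y) x))); last first.
      by rewrite -(addr0 (0 : R)); exact: cvgD.
    move=> n; rewrite rnorm_ge0/= -[X in _ <= X + _]rnormN -[X in _ <= _ + X]rnorm_conj.
    apply: le_trans (rnormD _ _).
    by rewrite rmorphB/= -!dotC root_iter_selfadjoint opprB subrKA.
  by apply: (@cvg_unique _ (@Rhausdorff R) _ _ _ _ _ h); exact: cvg_cst.
- move=> x; pose v n := root_iter n.+1 x.
  have vx : form_cvg dot v (Y x).
    have := YE x; rewrite /form_cvg => h.
    have := cvg_comp _ _ (cvg_addnr 1) h.
    by rewrite /comp; under eq_fun do rewrite addn1.
  apply: (form_cvg_unique vx); rewrite /v /=.
  apply/form_cvgZ/form_cvgD; first exact: form_cvg_cst.
  apply: (@squeeze0 _ _ (fun n => fnorm (root_iter n x - Y x) +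
      fnorm (root_iter n (Y x) - Y (Y x)))); last first.
    by rewrite -(addr0 (0 : R)); apply: cvgD; exact: YE.
  move=> n; rewrite fnorm_ge0/=.
  apply: le_trans (fnormB_le _ _ (root_iter n (Y x)) _) _; apply: lerD => //.
  rewrite -(raw_linearB (root_iter_linear n)) (le_trans (root_iter_le _ _))//.
  by rewrite ler_piMl ?fnorm_ge0//; have /andP[] := root_bound_itv n.
Qed.

End positive_contraction.

(** B is the square root of G, that is sqrt M (1 - Y) with Y the fixed point for
    A = 1 - G / M; being selfadjoint, it factors the form of G. *)
Lemma positive_factor (G : V -> V) (M : R) : linear G -> 0 < M ->
    (forall x, 0 <= dot (G x) x) ->
    (forall x, Re (dot (G x) x) <= M * fnorm x ^+ 2) ->
  exists2 B : V -> V, linear B & forall x y, dot (B x) (B y) = dot (G x) y.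
Proof.
move=> G_linear M0 G_ge0 G_le.
pose A x := x - (M^-1)%:C%C *: G x.
have A_linear : linear A.
  move=> a x y; rewrite /A G_linear !scalerDr opprD addrACA scalerN scalerA.
  by rewrite mulrC -scalerA.
have dotA x : dot (A x) x = (fnorm x ^+ 2 - M^-1 * Re (dot (G x) x))%:C%C.
  by rewrite /A dotBl dotZl dotxx {1}(ge0_ReK (G_ge0 x)) -rmorphM -rmorphB.
have [|x|Y [Y_linear Y_sa YE]] := @root_fixpoint A A_linear.
- by move=> x; rewrite dotA ler0c subr_ge0 mulrC ler_pdivrMr// mulrC.
- by rewrite dotA/= gerBl mulr_ge0 ?invr_ge0 ?(ltW M0)// ge0_Re_ge0.
exists (fun x => (Num.sqrt M)%:C%C *: (x - Y x)).
  move=> a x y; rewrite Y_linear scalerA mulrC -scalerA -scalerDr; congr (_ *: _).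
  by rewrite scalerBr opprD addrACA.
move=> x y; rewrite dotZl dotZr mulrA.
have -> : (Num.sqrt M)%:C%C * ((Num.sqrt M)%:C%C)^* = M%:C%C.
  rewrite -[(_)^*]/((Num.sqrt M)%:C^*)%C conjc_real -rmorphM/= -expr2.
  by rewrite sqr_sqrtr// ltW.
have Y_id z : dot (z - Y z) (y - Y y) = dot (z - Y z - Y (z - Y z)) y.
  by rewrite dotBr -Y_sa -dotBl.
rewrite Y_id -dotZl; congr (dot _ _).
have H : Y x + Y x = A x + Y (Y x).
  have := YE x => {1 2}->; rewrite -scalerDl.
  have -> : (2^-1 + 2^-1 : R[i]) = 1 by field.
  by rewrite scale1r.
have -> : x - Y x - Y (x - Y x) = x - A x.
  by rewrite (raw_linearB Y_linear) -addrA -opprD [Y x + _]addrA H addrK.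
rewrite /A opprB addrCA subrr addr0 scalerA -rmorphM/= divff ?gt_eqF//.
by rewrite scale1r.
Qed.

End positive_root.

Section neumann.
Context (R : realType) (V : lmodType R[i]) (dot : {dot V for Num.conj}).
Hypothesis V_complete : form_complete dot.
Local Notation fnorm := (fnorm dot).
Context (L : V -> V) (L_linear : linear L) (q : R) (q01 : 0 <= q < 1).
Hypothesis L_le : forall x, fnorm (L x) <= q * fnorm x.

Lemma neumann_uniq x : x = L x -> x = 0.
Proof.
move=> xE; apply: (fnorm0_eq0 (dot := dot)).
have := L_le x; rewrite -xE -subr_le0 -[X in X - _]mul1r -mulrBl => h.
have /andP[_ q1] := q01.
rewrite pmulr_rle0 ?subr_gt0// in h.
by apply/eqP; rewrite eq_le h fnorm_ge0.
Qed.

Lemma neumann : exists N : V -> V, forall x, N x = x + L (N x).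
Proof.
have /andP[q0 q1] := q01.
pose s x n := iter n (fun y => x + L y) 0.
have sS x n : s x n.+1 = x + L (s x n) by [].
have /choice[N NE] x : exists y, form_cvg dot (s x) y.
  apply: (cauchy_dominated (b := fun n => (1 - q ^+ n) / (1 - q) * fnorm x)) => //.
    apply: is_cvgMl; apply: is_cvgMl; apply: is_cvgB; first exact: is_cvg_cst.
    by apply/cvg_ex; exists 0; apply: cvg_expr; rewrite ger0_norm.
  move=> n; rewrite -mulrBl.
  have -> : (1 - q ^+ n.+1) / (1 - q) - (1 - q ^+ n) / (1 - q) = q ^+ n.
    by rewrite exprS; field; rewrite subr_eq0 gt_eqF.
  elim: n => [|n IH]; first by rewrite /s/= raw_linear0// addr0 subr0 expr0 mul1r.
  rewrite !sS opprD addrACA subrr add0r -(raw_linearB L_linear).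
  by rewrite (le_trans (L_le _))// exprS -mulrA ler_wpM2l.
have NL x : N x = x + L (N x).
  have vx : form_cvg dot (fun n => s x n.+1) (N x).
    have := NE x; rewrite /form_cvg => h.
    have := cvg_comp _ _ (cvg_addnr 1) h.
    by rewrite /comp; under eq_fun do rewrite addn1.
  apply: (form_cvg_unique vx); apply: form_cvgD; first exact: form_cvg_cst.
  apply: (@squeeze0 _ _ (fun n => q * fnorm (s x n - N x))).
    by move=> n; rewrite fnorm_ge0/= -(raw_linearB L_linear).
  by rewrite -(mulr0 q); apply: cvgMr; exact: NE.
by exists N.
Qed.

Lemma neumann_le N : (forall x, N x = x + L (N x)) ->
  forall x, fnorm (N x) <= (1 - q)^-1 * fnorm x.
Proof.
move=> NE x; have /andP[_ q1] := q01.
rewrite ler_pdivlMl ?subr_gt0// mulrBl mul1r lerBlDr.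
by rewrite {1}NE (le_trans (fnormD _ _ _))// lerD2l.
Qed.

End neumann.

(** * The inner product of the sequence space *)

Section complex_limits.
Context (R : realType).
Local Notation C := R[i].
Local Notation Re := complex.Re.
Local Notation Im := complex.Im.
Implicit Types (s : nat -> C) (l : C).

Lemma rnorm_le_parts (a : C) : rnorm a <= `|Re a| + `|Im a|.
Proof.
rewrite -(@ler_pXn2r _ 2) ?nnegrE ?addr_ge0 ?rnorm_ge0// rnorm_sqr sqrrD.
by rewrite !real_normK ?num_real// lerD2r lerDl mulrn_wge0// mulr_ge0.
Qed.

Definition complex_cvg s l : Prop := (s : nat -> C^o) @ \oo --> (l : C^o).

Lemma cvg_complexP s l : complex_cvg s l <->
  (fun n => rnorm (s n - l)) @ \oo --> (0 : R).
Proof.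
split=> [/(@cvgrPdist_lt _ C^o) h|h].
  apply/cvgrPdist_lt => e e0; have /h : 0 < e%:C%C by rewrite ltcE/= eqxx.
  apply: filterS => n /= hn; rewrite sub0r normrN ger0_norm ?rnorm_ge0//.
  by rewrite -rnormN opprB -ltcR rnormE.
apply/(@cvgrPdist_lt _ C^o) => e e0.
have eE : e = (Re e)%:C%C by apply: ge0_ReK; exact: ltW.
have {}e0 : 0 < Re e by move: e0; rewrite ltcE/= => /andP[].
move/cvgrPdist_lt : h => /(_ _ e0).
apply: filterS => n /=; rewrite sub0r normrN ger0_norm ?rnorm_ge0//.
by rewrite -rnormN opprB eE -ltcR rnormE.
Qed.

Lemma cvg_Re s l : complex_cvg s l -> (fun n => Re (s n)) @ \oo --> Re l.
Proof.
move=> /cvg_complexP h; apply/cvgrPdist_le => e e0.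
move/cvgrPdist_le : h => /(_ e e0); apply: filterS => n /=.
rewrite sub0r normrN ger0_norm ?rnorm_ge0//; apply: le_trans.
by rewrite distrC -Re_opp -Re_add -lecR rnormE normc_ge_Re.
Qed.

Lemma cvg_complex_parts s (a b : R) : (fun n => Re (s n)) @ \oo --> a ->
  (fun n => Im (s n)) @ \oo --> b -> complex_cvg s (Complex a b).
Proof.
move=> sa sb; apply/cvg_complexP.
apply: (@squeeze0 _ _ (fun n => `|Re (s n) - a| + `|Im (s n) - b|)).
  move=> n; rewrite rnorm_ge0/=; have := rnorm_le_parts (s n - Complex a b).
  by case: (s n).
rewrite -(addr0 (0 : R)); apply: cvgD; rewrite -(normr0 R); apply: cvg_norm.
  by rewrite -(subrr a); apply: cvgB => //; exact: cvg_cst.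
by rewrite -(subrr b); apply: cvgB => //; exact: cvg_cst.
Qed.

Lemma cvg_complex_unique s l1 l2 :
  complex_cvg s l1 -> complex_cvg s l2 -> l1 = l2.
Proof. exact: (@cvg_unique C^o (@norm_hausdorff _ C^o)). Qed.

End complex_limits.

Section finite_CauchySchwarz.
Context (R : realType).

Lemma sum_CauchySchwarz (I : Type) (r : seq I) (a b : I -> R) :
  (forall i, 0 <= a i) -> (forall i, 0 <= b i) ->
  (\sum_(i <- r) a i * b i) ^+ 2 <=
    (\sum_(i <- r) a i ^+ 2) * (\sum_(i <- r) b i ^+ 2).
Proof.
move=> a0 b0; elim: r => [|i r]; first by rewrite !big_nil expr0n mulr0.
rewrite !big_cons.
have : 0 <= \sum_(j <- r) a j * b j by apply: sumr_ge0 => j _; rewrite mulr_ge0.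
have : 0 <= \sum_(j <- r) a j ^+ 2 by apply: sumr_ge0 => j _; rewrite sqr_ge0.
have : 0 <= \sum_(j <- r) b j ^+ 2 by apply: sumr_ge0 => j _; rewrite sqr_ge0.
move: (\sum_(j <- r) a j ^+ 2) (\sum_(j <- r) b j ^+ 2) (\sum_(j <- r) a j * b j).
move: (a i) (a0 i) (b i) (b0 i) => x x0 y y0 A B S B0 A0 S0 SAB.
have h : 2 * S * (x * y) <= A * y ^+ 2 + B * x ^+ 2.
  rewrite -(@ler_pXn2r _ 2) ?nnegrE ?addr_ge0 ?mulr_ge0 ?sqr_ge0 ?exprn_ge0//.
  apply: (@le_trans _ _ (4 * (A * B) * (x * y) ^+ 2)).
    rewrite exprMn ler_wpM2r ?sqr_ge0// exprMn.
    have -> : 2 ^+ 2 = 4 :> R by ring.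
    by rewrite ler_wpM2l.
  rewrite -subr_ge0 (_ : _ - _ = (A * y ^+ 2 - B * x ^+ 2) ^+ 2); last by ring.
  exact: sqr_ge0.
have -> : (x * y + S) ^+ 2 = x ^+ 2 * y ^+ 2 + (2 * S * (x * y) + S ^+ 2) by ring.
have -> : (x ^+ 2 + A) * (y ^+ 2 + B) =
    x ^+ 2 * y ^+ 2 + (A * y ^+ 2 + B * x ^+ 2 + A * B) by ring.
by rewrite lerD2l lerD.
Qed.

(** The case of V (x) C^r of the Cauchy-Schwarz inequality, by the triangle
    inequality and the scalar case. *)
Lemma fnorm_sum_le (V : lmodType R[i]) (dot : {dot V for Num.conj}) (I : Type)
    (r : seq I) (z : I -> R[i]) (y : I -> V) :
  fnorm dot (\sum_(i <- r) z i *: y i) ^+ 2 <=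
    (\sum_(i <- r) rnorm (z i) ^+ 2) * (\sum_(i <- r) fnorm dot (y i) ^+ 2).
Proof.
apply: le_trans (sum_CauchySchwarz _ _ _) => [|i|i]; last 2 first.
- exact: rnorm_ge0.
- exact: fnorm_ge0.
rewrite ler_pXn2r ?nnegrE ?fnorm_ge0//; last first.
  by apply: sumr_ge0 => i _; rewrite mulr_ge0 ?rnorm_ge0 ?fnorm_ge0.
elim: r => [|i r IH]; first by rewrite !big_nil fnorm0.
by rewrite !big_cons (le_trans (fnormD _ _ _))// fnormZ lerD2l.
Qed.

End finite_CauchySchwarz.

Section l2_inner_product.
Context (R : realType) (n : option nat).
Local Notation C := R[i].
Local Notation Re := complex.Re.
Local Notation Im := complex.Im.
Implicit Types x y z : l2 R n.

Definition l2psum x y (N : nat) : C := \sum_(0 <= i < N) x i * (y i)^*%C.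

Lemma rnorm_l2 x : rnorm x = l2norm_seq x.
Proof. by []. Qed.

Lemma sqs_le_rnorm x N : sqs x N <= rnorm x ^+ 2.
Proof.
by rewrite rnorm_l2 /l2norm_seq sqr_sqrtr ?sqs_lim_ge0// sqs_le_lim//; exact: l2_cvg.
Qed.

(** The real and the imaginary part of the series converge absolutely, their
    terms being at most |x_i|^2 + |y_i|^2. *)
Lemma l2dot_cvg x y : complex_cvg (l2psum x y) (l2dot x y).
Proof.
have H (f : C -> R) : (forall a b, f (a + b) = f a + f b) -> f 0 = 0 ->
    (forall a, `|f a| <= rnorm a) -> cvgn (fun N => f (l2psum x y N)).
  move=> fD f0 f_le.
  have -> : (fun N => f (l2psum x y N)) = series (fun i => f (x i * (y i)^*%C)).
    by apply/funext => N; rewrite /l2psum (big_morph f fD f0).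
  apply: normed_cvg.
  apply: (series_le_cvg (v_ := fun i => rnorm (x i) ^+ 2 + rnorm (y i) ^+ 2)) => [i|i|i|].
  - exact: normr_ge0.
  - by rewrite addr_ge0 ?sqr_ge0.
  - rewrite (le_trans (f_le _))// rnormM -[_^*%C]/(Num.conj _) rnorm_conj.
    have := sqr_ge0 (rnorm (x i) - rnorm (y i)).
    have := mulr_ge0 (rnorm_ge0 (x i)) (rnorm_ge0 (y i)).
    by rewrite sqrrB -mulr_natl; lra.
  - rewrite (_ : series _ = sqs x + sqs y).
      by apply: is_cvgD; exact: l2_cvg.
    by apply/funext => N; rewrite /sqs /series/= fctE big_split.
have /cvg_ex[/= a sa] : cvgn (fun N => Re (l2psum x y N)).
  apply: H => // [? ?|b]; first exact: Re_add.
  by rewrite -lecR rnormE normc_ge_Re.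
have /cvg_ex[/= b sb] : cvgn (fun N => Im (l2psum x y N)).
  apply: H => // [[? ?] [? ?]//|c].
  rewrite -(@ler_pXn2r _ 2) ?nnegrE ?rnorm_ge0// rnorm_sqr real_normK ?num_real//.
  by rewrite lerDr sqr_ge0.
have h := cvg_complex_parts sa sb.
have -> : l2dot x y = Complex a b; last exact: h.
by apply: (@cvg_lim C^o); [exact: norm_hausdorff|exact: h].
Qed.

Lemma l2dot_linear a x y z : l2dot (a *: x + y) z = a * l2dot x z + l2dot y z.
Proof.
apply: (cvg_complex_unique (@l2dot_cvg _ _)).
rewrite (_ : l2psum _ _ = fun N => a *: (l2psum x z N : C^o) + (l2psum y z N : C^o)).
  by apply: cvgD; [apply: cvgZr; exact: l2dot_cvg|exact: l2dot_cvg].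
apply/funext => N; rewrite /l2psum scaler_sumr -big_split; apply: eq_bigr => i _ /=.
by rewrite mulrDl -mulrA.
Qed.

Lemma rnorm_l2dot_le x y : rnorm (l2dot x y) <= rnorm x * rnorm y.
Proof.
have h : (fun N => rnorm (l2psum x y N)) @ \oo --> rnorm (l2dot x y).
  apply/cvgrPdist_le => e e0.
  have /cvg_complexP/cvgrPdist_le/(_ e e0) := @l2dot_cvg x y.
  apply: filterS => N /=; rewrite sub0r normrN ger0_norm ?rnorm_ge0//.
  apply: le_trans; rewrite ler_norml.
  have := rnormD (l2psum x y N - l2dot x y) (l2dot x y).
  have := rnormD (l2dot x y - l2psum x y N) (l2psum x y N).
  rewrite !subrK -[l2dot x y - _]opprB rnormN => h1 h2.
  by apply/andP; split; lra.
apply: (@ler_cvg_to _ _ _ _ _ _ _ _ h (cvg_cst (rnorm x * rnorm y))).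
apply: nearW => N /=.
apply: (@le_trans _ _ (\sum_(0 <= i < N) rnorm (x i) * rnorm (y i))).
  rewrite /l2psum; elim/big_rec2: _ => [|i u v _ h1]; first by rewrite rnorm0.
  by rewrite (le_trans (rnormD _ _))// lerD// rnormM -[_^*%C]/(Num.conj _) rnorm_conj.
have x0 := rnorm_ge0 x; have y0 := rnorm_ge0 y.
rewrite -(@ler_pXn2r _ 2) ?nnegrE ?mulr_ge0//; last first.
  by apply: sumr_ge0 => i _; rewrite mulr_ge0 ?rnorm_ge0.
apply: le_trans (sum_CauchySchwarz _ _ _) _ => [i|i|]; try exact: rnorm_ge0.
by rewrite exprMn ler_pM ?sqs_le_rnorm//; apply: sumr_ge0 => i _; rewrite sqr_ge0.
Qed.

Section gram.
Context (V : lmodType C) (dot : {dot V for Num.conj}) (I : finType).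
Context (lam : I -> l2 R n) (x : I -> V).

(** The squared norm of sum_i x_i (x) conj (lam i) in the tensor product of V
    with l2, whose coordinate at l is sum_i conj (lam i l) x_i. *)
Definition tensor_sqr : R :=
  Re (\sum_i \sum_j l2dot (lam j) (lam i) * dot (x i) (x j)).

Lemma tensor_sqr_cvg : (fun N => \sum_(0 <= l < N)
    fnorm dot (\sum_i (lam i l)^* *: x i) ^+ 2) @ \oo --> tensor_sqr.
Proof.
have -> : (fun N => \sum_(0 <= l < N) fnorm dot (\sum_i (lam i l)^* *: x i) ^+ 2)
    = fun N => Re (\sum_i \sum_j l2psum (lam j) (lam i) N * dot (x i) (x j)).
  apply/funext => N.
  under eq_bigr do rewrite fnorm_sqr.
  rewrite -Re_sum; congr (Re _).
  under eq_bigr do rewrite dot_suml.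
  rewrite exchange_big; apply: eq_bigr => i _ /=.
  under eq_bigr do rewrite dot_sumr.
  rewrite exchange_big; apply: eq_bigr => j _ /=.
  rewrite /l2psum mulr_suml; apply: eq_bigr => l _.
  by rewrite dotZl dotZr conjCK mulrA [_ * lam j l]mulrC.
apply: cvg_Re.
have S (s : I -> nat -> C) (l : I -> C) : (forall i, complex_cvg (s i) (l i)) ->
    complex_cvg (fun N => \sum_i s i N) (\sum_i l i).
  move=> sl; elim: (index_enum I) => [|i r IH].
    rewrite big_nil; under eq_fun do rewrite big_nil.
    exact: (@cvg_cst C^o).
  rewrite big_cons; under eq_fun do rewrite big_cons.
  exact: (cvgD (sl i) IH).
apply: (S (fun i N => _)) => i; apply: (S (fun j N => _)) => j.
under eq_fun do rewrite mulrC; rewrite mulrC.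
exact: (@cvgZr _ C^o _ _ _ _ _ _ (@l2dot_cvg _ _)).
Qed.

Lemma tensor_sqr_ge0 : 0 <= tensor_sqr.
Proof.
apply: (@ler_cvg_to _ _ _ _ _ _ _ _ (cvg_cst 0) tensor_sqr_cvg).
by apply: nearW => N; apply: sumr_ge0 => l _; exact: sqr_ge0.
Qed.

(** Pairing an element of V (x) l2 with z has norm at most |z|.  The partial
    sums over the coordinates of l2 satisfy it by [fnorm_sum_le]. *)
Lemma tensor_contraction z :
  fnorm dot (\sum_i l2dot z (lam i) *: x i) ^+ 2 <= rnorm z ^+ 2 * tensor_sqr.
Proof.
have c1 : form_cvg dot (fun N => \sum_i l2psum z (lam i) N *: x i)
    (\sum_i l2dot z (lam i) *: x i).
  elim: (index_enum I) => [|i r IH].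
    rewrite big_nil /form_cvg; under eq_fun do rewrite big_nil.
    exact: form_cvg_cst.
  rewrite big_cons /form_cvg; under eq_fun do rewrite big_cons.
  apply: form_cvgD IH; rewrite /form_cvg; under eq_fun do rewrite -scalerBl fnormZ.
  rewrite -(mul0r (fnorm dot (x i))); apply: cvgMl.
  by apply/cvg_complexP; exact: l2dot_cvg.
have c2 := form_cvg_fnorm c1.
have c4 : (fun N => rnorm z ^+ 2 * \sum_(0 <= l < N)
    fnorm dot (\sum_i (lam i l)^* *: x i) ^+ 2) @ \oo --> rnorm z ^+ 2 * tensor_sqr.
  by apply: cvgMr; exact: tensor_sqr_cvg.
rewrite expr2; apply: (ler_cvg_to (cvgM c2 c2) c4); apply: nearW => N /=.
rewrite -[leLHS]expr2.
have -> : \sum_i l2psum z (lam i) N *: x i =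
    \sum_(0 <= l < N) z l *: (\sum_i (lam i l)^* *: x i).
  under [RHS]eq_bigr do rewrite scaler_sumr.
  rewrite exchange_big; apply: eq_bigr => i _; rewrite /l2psum scaler_suml.
  by apply: eq_bigr => l _; rewrite scalerA.
apply: le_trans (fnorm_sum_le _ _ _ _) _; rewrite ler_wpM2r ?sqs_le_rnorm//.
by apply: sumr_ge0 => l _; exact: sqr_ge0.
Qed.

End gram.

End l2_inner_product.

(** * Analyticity of transfer functions *)

Section bop_facts.
Context (R : realType) (K : normedModType R[i]).

Lemma bop_is_bop (f : K -> K) (M : R) : linear f ->
  (forall u, rnorm (f u) <= M * rnorm u) -> is_bop f.
Proof.
move=> lf fM; split=> //; exists M%:C%C => u.
by rewrite -!rnormE -rmorphM/= lecR.
Qed.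

Lemma is_bop_bound (T : bop K) :
  exists2 M : R, 0 <= M & forall u, rnorm (T u) <= M * rnorm u.
Proof.
have [_ [M TM]] := bopP T; exists (rnorm M); first exact: rnorm_ge0.
move=> u; rewrite -lecR rmorphM/= !rnormE -[`|u| in X in _ <= X]normr_id -normrM.
by rewrite (le_trans (TM u))// real_ler_norm// ger0_real// (le_trans _ (TM u)).
Qed.

Definition mk_bop (f : K -> K) (fb : is_bop f) : bop K :=
  Bop (introT (asboolP _) fb).

Lemma bop_eq (S T : bop K) : (forall u, S u = T u) -> S = T.
Proof. by move=> ST; apply/val_inj/funext. Qed.

Lemma bop_sumE (I : Type) (r : seq I) (P : pred I) (F : I -> bop K) u :
  (\sum_(i <- r | P i) F i) u = \sum_(i <- r | P i) F i u.
Proof. exact: (big_morph (fun T : bop K => T u)). Qed.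

Lemma bop_norm_le (T : bop K) (M : R) : 0 <= M ->
  (forall u, rnorm (T u) <= M * rnorm u) -> rnorm T <= M.
Proof.
move=> M0 TM; rewrite -[rnorm T]/(opnorm T); apply: opnorm_le => u u1.
rewrite (le_trans (TM u))// ler_piMr//.
by rewrite -lecR rnormE.
Qed.

End bop_facts.

Section transfer_function.
Context (R : realType) (E K : normedModType R[i]) (H : lmodType R[i]).
Context (dot : {dot H for Num.conj}).
Local Notation fnorm := (fnorm dot).
Context (L : E -> H -> H) (N : E -> H -> H) (V : H -> K) (J : K -> H).
Hypothesis L_linearl : forall x, linear (L^~ x).
Hypothesis L_linear : forall z, linear (L z).
Hypothesis L_le : forall z x, fnorm (L z x) <= rnorm z * fnorm x.
Hypothesis NE : forall z, rnorm z < 1 -> forall x, N z x = x + L z (N z x).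
Hypothesis V_linear : linear V.
Hypothesis V_le : forall x, rnorm (V x) <= fnorm x.
Hypothesis J_linear : linear J.
Hypothesis J_le : forall u, fnorm (J u) <= rnorm u.

(** N z is the resolvent (1 - L z)^-1, known only through its fixed point
    equation; uniqueness of the fixed point yields all its algebraic
    properties. *)
Lemma resolvent_uniq z x y : rnorm z < 1 -> y = x + L z y -> y = N z x.
Proof.
move=> z1 yE; apply/eqP; rewrite -subr_eq0; apply/eqP.
apply: (@neumann_uniq _ _ dot (L z) (rnorm z)).
- by rewrite rnorm_ge0.
- exact: L_le.
- rewrite (raw_linearB (L_linear z)) {1}yE {1}(NE z1 x).
  by rewrite opprD addrACA subrr add0r.
Qed.

Lemma resolvent_linear z : rnorm z < 1 -> linear (N z).
Proof.
move=> z1 a x y; apply/esym/resolvent_uniq => //.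
by rewrite L_linear {1}(NE z1 x) {1}(NE z1 y) scalerDr addrACA.
Qed.

Lemma resolvent_le z x : rnorm z < 1 ->
  fnorm (N z x) <= (1 - rnorm z)^-1 * fnorm x.
Proof.
move=> z1; apply: (@neumann_le _ _ _ (L z)) => //; first by rewrite rnorm_ge0.
exact: NE.
Qed.

Section expansion.
Context (a : E) (a1 : rnorm a < 1).
Let c := (1 - rnorm a)^-1.

Let c_gt0 : 0 < c.
Proof. by rewrite invr_gt0 subr_gt0. Qed.

(** The product of the operators (1 - L a)^-1 L (v i), for i along s; for
    s = enum 'I_m this is, up to a right factor (1 - L a)^-1, the m-linear
    coefficient of the Neumann series of (1 - L z)^-1 at a.  Words over any list
    of slots make multilinearity an induction on s. *)
Definition coeff_word (T : Type) (v : T -> E) (s : seq T) (x : H) : H :=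
  foldr (fun i y => N a (L (v i) y)) x s.

Lemma coeff_word_linear (T : Type) (v : T -> E) s : linear (coeff_word v s).
Proof.
elim: s => [|i s IH] b x y //=.
by rewrite IH L_linear (resolvent_linear a1).
Qed.

Lemma coeff_word_le (T : Type) (v : T -> E) s x :
  fnorm (coeff_word v s x) <= c ^+ size s * (\prod_(i <- s) rnorm (v i)) * fnorm x.
Proof.
elim: s => [|i s IH] /=; first by rewrite big_nil expr0 !mul1r.
apply: le_trans (resolvent_le _ a1) _; rewrite -/c exprS big_cons -!mulrA.
rewrite ler_wpM2l ?(ltW c_gt0)//; apply: le_trans (L_le _ _) _.
by rewrite mulrCA ler_wpM2l ?rnorm_ge0// mulrA.
Qed.

(** Linearity in slot i needs the slot to occur exactly once, whence the
    induction over duplicate-free words with the companion claim that a word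
    avoiding i does not depend on it. *)
Lemma coeff_word_multilinear m (v : 'I_m -> E) (i : 'I_m) s x : uniq s ->
  (i \in s -> linear (fun z => coeff_word (subst_at v i z) s x)) /\
  (i \notin s -> forall z, coeff_word (subst_at v i z) s x = coeff_word v s x).
Proof.
elim: s => [|j s IH]//= /andP[js us]; have [IH1 IH2] := IH us.
rewrite !inE; split.
  have [ji|ij] := eqVneq j i.
    rewrite ji in js *; move=> _ b z w; rewrite !IH2// /subst_at eqxx.
    by rewrite L_linearl (resolvent_linear a1).
  rewrite /= => si b z w.
  by rewrite IH1// /subst_at (negbTE ij) L_linear (resolvent_linear a1).
rewrite negb_or => /andP[ij si] z.
by rewrite IH2// /subst_at eq_sym (negbTE ij).
Qed.

Lemma coeff_word_const m e x :
  coeff_word (fun=> e) (enum 'I_m) x = iter m (fun y => N a (L e y)) x.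
Proof.
rewrite [in RHS](esym (size_enum_ord m)).
by elim: (enum 'I_m) => //= i s ->.
Qed.

Lemma coeff_word_transfer_le m (v : 'I_m -> E) u :
  rnorm (V (coeff_word v (enum 'I_m) (N a (J u)))) <=
    c ^+ m.+1 * (\prod_i rnorm (v i)) * rnorm u.
Proof.
rewrite (le_trans (V_le _))// (le_trans (coeff_word_le _ _ _))//.
rewrite size_enum_ord big_enum exprSr -!mulrA ler_wpM2l ?exprn_ge0 ?(ltW c_gt0)//.
rewrite mulrCA ler_wpM2l//; first by apply: prodr_ge0 => i _; exact: rnorm_ge0.
by rewrite (le_trans (resolvent_le _ a1))// ler_wpM2l ?(ltW c_gt0).
Qed.

Lemma coeff_bop m (v : 'I_m -> E) :
  is_bop (fun u => V (coeff_word v (enum 'I_m) (N a (J u)))).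
Proof.
apply: (bop_is_bop _ (coeff_word_transfer_le v)) => b x y.
by rewrite J_linear (resolvent_linear a1) coeff_word_linear V_linear.
Qed.

Definition taylor_form m (v : 'I_m -> E) : bop K := mk_bop (coeff_bop v).

Lemma taylor_form_multilinear m : bounded_multilinear (@taylor_form m).
Proof.
split=> [v i b z w|].
  apply: bop_eq => u /=.
  have [h _] := coeff_word_multilinear v i (N a (J u)) (enum_uniq 'I_m).
  by rewrite (h (mem_enum _ _)) V_linear.
exists (c ^+ m.+1)%:C%C => v.
have -> : \prod_(i < m) `|v i| = (\prod_(i < m) rnorm (v i))%:C%C.
  by rewrite rmorph_prod; apply: eq_bigr => i _; exact/esym/rnormE.
rewrite -rnormE -rmorphM/= lecR; apply: bop_norm_le.
  by rewrite mulr_ge0 ?exprn_ge0 ?(ltW c_gt0)// prodr_ge0// => i _; exact: rnorm_ge0.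
exact: coeff_word_transfer_le.
Qed.

(** Since L z = L a + L (z - a), the resolvents satisfy
    N z = N a + N a (L (z - a)) (N z); iterate M times. *)
Lemma resolvent_expansion z x M : rnorm z < 1 ->
  N z x = \sum_(m < M) iter m (fun y => N a (L (z - a) y)) (N a x) +
          iter M (fun y => N a (L (z - a) y)) (N z x).
Proof.
move=> z1; have lin : linear (fun y => N a (L (z - a) y)).
  by move=> b y w; rewrite L_linear (resolvent_linear a1).
have lin_iter m : linear (iter m (fun y => N a (L (z - a) y))).
  by elim: m => [|m IH] b y w //=; rewrite IH lin.
elim: M => [|M IH]; first by rewrite big_ord0 add0r.
rewrite big_ord_recr {1}IH -addrA iterSr -(raw_linearD (lin_iter M)).
congr (_ + iter M _ _); rewrite -(raw_linearD (resolvent_linear a1)).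
apply: resolvent_uniq => //; rewrite -addrA -(raw_linearD (L_linearl _)) subrK.
exact: NE.
Qed.

End expansion.

(** On the ball of radius (1 - |a|) / 2 around a, the operator
    (1 - L a)^-1 L (z - a) has norm at most 1/2, so the remainder after M terms
    is at most 2^-M times the norm of the resolvent at z, which is bounded by
    the inverse of that radius. *)
Lemma transfer_analytic (F : E -> bop K) :
  (forall z, rnorm z < 1 -> forall u, F z u = V (N z (J u))) ->
  analytic_on [set z | `|z| < 1] F.
Proof.
move=> FE a; rewrite /mkset -rnormE -[1]/(1%:C)%C ltcR => a1.
pose r : R := (1 - rnorm a) / 2.
have r0 : 0 < r by rewrite divr_gt0// subr_gt0.
have ballE z : ball a r%:C%C z -> rnorm (z - a) < r.
  by rewrite -ball_normE /ball_/= distrC -ltcR rnormE.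
have ball1 z : ball a r%:C%C z -> rnorm z < 1 - r.
  move=> /ballE h; rewrite -[z](subrK a) (le_lt_trans (rnormD _ _))//.
  by rewrite /r in h *; lra.
exists r%:C%C, (fun m e => taylor_form a1 (fun _ : 'I_m => e)); split.
- by rewrite ltcE/= eqxx.
- move=> z /ball1 h /=; suff : rnorm z < 1 by rewrite -ltcR rnormE.
  by lra.
- by move=> m; exists (taylor_form a1 (m := m)) => //; exact: taylor_form_multilinear.
move=> P /uniform_nbhs[D [entD DP]].
move: entD; rewrite -entourage_ballE => -[e /= e0 eD].
have eE : e = (complex.Re e)%:C%C by apply: ge0_ReK; exact: ltW.
have {}e0 : 0 < complex.Re e by move: e0; rewrite ltcE/= => /andP[].
have small : (fun M : nat => 2^-1 ^+ M * r^-1 : R) @ \oo --> (0 * r^-1 : R).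
  by apply: cvgMl; apply: cvg_expr; rewrite ger0_norm ?invr_ge0// invf_lt1// ltr1n.
rewrite mul0r in small; move/cvgrPdist_lt : small => /(_ _ e0).
apply: filterS => M /= hM; apply: DP => z za /=; apply: eD => /=.
rewrite -ball_normE /ball_/= eE -rnormE ltcR; apply: le_lt_trans hM.
have z1 : rnorm z < 1 by have := ball1 _ za; lra.
rewrite sub0r normrN ger0_norm ?mulr_ge0 ?exprn_ge0 ?invr_ge0// ?(ltW r0)//.
apply: bop_norm_le; first by rewrite mulr_ge0 ?exprn_ge0 ?invr_ge0// (ltW r0).
move=> u.
have -> : (F z - \sum_(m < M) taylor_form a1 (fun _ : 'I_m => z - a)) u =
    V (iter M (fun y => N a (L (z - a) y)) (N z (J u))).
  rewrite -[LHS]/(F z u - (\sum_(m < M) taylor_form a1 (fun _ : 'I_m => z - a)) u).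
  rewrite bop_sumE FE// {1}(resolvent_expansion a1 (J u) M z1).
  rewrite (raw_linearD V_linear) (raw_linear_sum V_linear) addrAC.
  rewrite -[RHS]add0r; congr (_ + _); apply/eqP; rewrite subr_eq0; apply/eqP.
  by apply: eq_bigr => m _; rewrite /= coeff_word_const.
rewrite (le_trans (V_le _))// -mulrA.
have q2 y : fnorm (N a (L (z - a) y)) <= 2^-1 * fnorm y.
  rewrite (le_trans (resolvent_le _ a1))// ler_pdivrMl ?subr_gt0// mulrA.
  rewrite (le_trans (L_le _ _))// ler_wpM2r ?fnorm_ge0//.
  by have := ballE _ za; rewrite /r => /ltW.
apply: (@le_trans _ _ (2^-1 ^+ M * fnorm (N z (J u)))).
  elim: M => [|M IH] /=; first by rewrite mul1r.
  by rewrite (le_trans (q2 _))// exprS -mulrA ler_wpM2l ?invr_ge0.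
rewrite ler_wpM2l ?exprn_ge0 ?invr_ge0// (le_trans (resolvent_le _ z1))//.
apply: ler_pM => //; rewrite ?invr_ge0 ?subr_ge0 ?fnorm_ge0 ?(ltW z1)//.
by rewrite lef_pV2 ?posrE ?subr_gt0//; have := ball1 _ za; lra.
Qed.

End transfer_function.

(** * The lurking isometry *)

Lemma pair_ext (A B : Type) (x y : A * B) : x.1 = y.1 -> x.2 = y.2 -> x = y.
Proof. by case: x y => [a b] [c d] /= -> ->. Qed.

Section pair_form.
Context (R : realType) (V1 V2 : lmodType R[i]).
Context (dot1 : {dot V1 for Num.conj}) (dot2 : {dot V2 for Num.conj}).

Definition pair_dot (x y : V1 * V2) : R[i] := dot1 x.1 y.1 + dot2 x.2 y.2.

Lemma pair_dot_bilinear : bilinear_for ( *%R) (Num.conj \; *%R) pair_dot.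
Proof.
split=> [y a u v|x a u v]; rewrite /pair_dot /= mulrDr addrACA.
  by rewrite !dotDl !dotZl.
by rewrite !dotDr !dotZr.
Qed.

HB.instance Definition _ := bilinear_isBilinear.Build R[i] (V1 * V2)%type
  (V1 * V2)%type R[i] ( *%R) (Num.conj \; *%R) pair_dot pair_dot_bilinear.

Lemma pair_dot_herm x y : pair_dot x y = (-1) ^+ false * (pair_dot y x)^*.
Proof. by rewrite expr0 mul1r rmorphD/= /pair_dot -!dotC. Qed.

HB.instance Definition _ := isHermitianSesquilinear.Build R[i] (V1 * V2)%type
  false Num.conj pair_dot pair_dot_herm.

Lemma pair_dot_gt0 x : x != 0 -> 0 < pair_dot x x.
Proof.
move=> x0; rewrite lt_def addr_ge0 ?dnorm_ge0// andbT.
apply: contra_neq x0 => /eqP; rewrite paddr_eq0 ?dnorm_ge0// !dnorm_eq0.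
by case: x => x1 x2 /= /andP[/eqP-> /eqP->].
Qed.

HB.instance Definition _ :=
  isDotProduct.Build R[i] (V1 * V2)%type pair_dot pair_dot_gt0.

Lemma pair_dotE x y : (pair_dot : {dot (V1 * V2)%type for Num.conj}) x y =
  dot1 x.1 y.1 + dot2 x.2 y.2.
Proof. by []. Qed.

Lemma fnorm_pair_dot x :
  fnorm pair_dot x ^+ 2 = fnorm dot1 x.1 ^+ 2 + fnorm dot2 x.2 ^+ 2.
Proof. by rewrite !fnorm_sqr -Re_add. Qed.

Lemma fnorm_fst_le x : fnorm dot1 x.1 <= fnorm pair_dot x.
Proof.
by rewrite -(@ler_pXn2r _ 2) ?nnegrE ?fnorm_ge0// fnorm_pair_dot lerDl sqr_ge0.
Qed.

Lemma fnorm_snd_le x : fnorm dot2 x.2 <= fnorm pair_dot x.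
Proof.
by rewrite -(@ler_pXn2r _ 2) ?nnegrE ?fnorm_ge0// fnorm_pair_dot lerDr sqr_ge0.
Qed.

Lemma form_cvg_fst (u : nat -> V1 * V2) l :
  form_cvg pair_dot u l -> form_cvg dot1 (fun n => (u n).1) l.1.
Proof.
move=> h; apply: (squeeze0 _ h) => n; rewrite fnorm_ge0/=.
exact: (fnorm_fst_le (u n - l)).
Qed.

Lemma pair_dot_complete :
  form_complete dot1 -> form_complete dot2 -> form_complete pair_dot.
Proof.
move=> c1 c2 u uc.
have [|l1 h1] := c1 (fun n => (u n).1).
  move=> e /uc[N h]; exists N => m n Nm Nn.
  exact: le_lt_trans (fnorm_fst_le (u m - u n)) (h _ _ Nm Nn).
have [|l2 h2] := c2 (fun n => (u n).2).
  move=> e /uc[N h]; exists N => m n Nm Nn.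
  exact: le_lt_trans (fnorm_snd_le (u m - u n)) (h _ _ Nm Nn).
exists (l1, l2); apply: (@squeeze0 _ _ (fun n =>
    fnorm dot1 ((u n).1 - l1) + fnorm dot2 ((u n).2 - l2))); last first.
  by rewrite -(addr0 (0 : R)); exact: cvgD.
move=> n; rewrite fnorm_ge0/= -(@ler_pXn2r _ 2) ?nnegrE ?addr_ge0 ?fnorm_ge0//.
by rewrite fnorm_pair_dot sqrrD lerD2r lerDl mulrn_wge0// mulr_ge0 ?fnorm_ge0.
Qed.

End pair_form.

Lemma form_cvg_dot_complex (R : realType) (V : lmodType R[i])
    (dot : {dot V for Num.conj}) (u : nat -> V) l y :
  form_cvg dot u l -> complex_cvg (fun n => dot (u n) y) (dot l y).
Proof. by move=> ul; apply/cvg_complexP; exact: form_cvg_dot. Qed.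

Section lurking_isometry.
Context (R : realType) (n : option nat) (K : normedModType R[i]).
Context (dot : {dot K for Num.conj}).
Hypothesis K_complete : form_complete dot.
Hypothesis rnormK : forall x : K, rnorm x = fnorm dot x.
Context (G : lmodType R[i]) (dotG : {dot G for Num.conj}).
Hypothesis G_complete : form_complete dotG.
Context (I : finType) (lam : I -> l2 R n) (W : I -> bop K) (Wa : I -> K -> K).
Hypothesis lam_ball : forall i, rnorm (lam i) < 1.
Hypothesis Wa_linear : forall i, linear (Wa i).
Hypothesis WaE : forall i x y, dot (W i x) y = dot x (Wa i y).
Context (gam : I -> K -> G).
Hypothesis gam_linear : forall i, linear (gam i).
Hypothesis gamE : forall i j u v,
  dot u v + l2dot (lam j) (lam i) * dotG (gam i u) (gam j v) =
  dot (Wa i u) (Wa j v) + dotG (gam i u) (gam j v).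

Local Notation X := (I -> K).
Local Notation H := (K * G)%type.
Local Notation dotH := (pair_dot dot dotG : {dot H for Num.conj}).

Let T (h : X) : H := (\sum_i Wa i (h i), \sum_i gam i (h i)).
Let S1 (h : X) : K := \sum_i h i.
Let S2 (z : l2 R n) (h : X) : H := (0, \sum_i l2dot z (lam i) *: gam i (h i)).
Let delta (j : I) (v : K) : X := fun i => if i == j then v else 0.

Let T_linear : linear T.
Proof.
move=> a x y; apply: pair_ext => /=; rewrite scaler_sumr -big_split;
  apply: eq_bigr => i _ /=; [exact: Wa_linear|exact: gam_linear].
Qed.

Let S1_linear : linear S1.
Proof. by move=> a x y; rewrite /S1 scaler_sumr -big_split. Qed.

Let S2_linear z : linear (S2 z).
Proof.
move=> a x y; apply: pair_ext => /=.
  by rewrite scaler0 addr0.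
rewrite scaler_sumr -big_split; apply: eq_bigr => i _ /=.
by rewrite gam_linear scalerDr !scalerA mulrC.
Qed.

Let S2_linearl h : linear (S2^~ h).
Proof.
move=> a z w; apply: pair_ext => /=.
  by rewrite scaler0 addr0.
rewrite scaler_sumr -big_split; apply: eq_bigr => i _ /=.
by rewrite l2dot_linear scalerDl scalerA.
Qed.

Let T_delta j v : T (delta j v) = (Wa j v, gam j v).
Proof.
apply: pair_ext; rewrite /T /= (bigD1 j)//= /delta eqxx big1 ?addr0//.
  by move=> i /negbTE->; rewrite (raw_linear0 (Wa_linear i)).
by move=> i /negbTE->; rewrite (raw_linear0 (gam_linear i)).
Qed.

(** Sum [gamE] over the components of h.  This is the isometry of
    T h |-> (sum_i h_i, sum_i gam_i h_i (x) conj (lam i)), polarized against the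
    image of an element supported at j, where the tensor conj (lam j) appears as
    the evaluation of S2 at z = lam j. *)
Let S_isometry j v h :
  dot (S1 h) v + dotH (S2 (lam j) h) (T (delta j v)) = dotH (T h) (T (delta j v)).
Proof.
rewrite T_delta !pair_dotE/= linear0l add0r !dot_suml -!big_split.
by apply: eq_bigr => i _ /=; rewrite dotZl gamE.
Qed.

(** Sum the polarized identity over the components of h. *)
Let T_norm h : fnorm dotH (T h) ^+ 2 =
  fnorm dot (S1 h) ^+ 2 + tensor_sqr dotG lam (fun i => gam i (h i)).
Proof.
rewrite !fnorm_sqr -Re_add; congr complex.Re.
have TE : T h = \sum_j T (delta j (h j)).
  rewrite -(raw_linear_sum T_linear); congr T; apply/funext => i.
  rewrite fct_sumE (bigD1 i)//= /delta eqxx big1 ?addr0// => j /negbTE.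
  by rewrite eq_sym => ->.
rewrite {2}TE dot_sumr; under eq_bigr do rewrite -S_isometry.
rewrite big_split/= -dot_sumr; congr (_ + _).
rewrite exchange_big; apply: eq_bigr => j _ /=.
rewrite T_delta pair_dotE/= linear0l add0r dot_suml.
by apply: eq_bigr => i _; rewrite dotZl.
Qed.

Let S2_le z h : fnorm dotH (S2 z h) ^+ 2 <=
  rnorm z ^+ 2 * tensor_sqr dotG lam (fun i => gam i (h i)).
Proof.
by rewrite fnorm_pair_dot/= fnorm0 expr0n add0r tensor_contraction.
Qed.

(** The hypothesis [gamE] is the isometry of the map
    T h |-> (sum_i h_i, sum_i gam_i h_i (x) conj (lam i)).  V and L z are the
    extensions of its first component and of its second component paired with
    z; the realization F z u = V (N z (u, 0)), N z = (1 - L z)^-1, has the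
    required properties. *)
Lemma lurking_isometry : exists F : l2 R n -> bop K,
  [/\ analytic_on [set z | `|z| < 1] F,
      forall z u, rnorm (F z u) <= rnorm u &
      forall j, F (lam j) = W j].
Proof.
have H_complete : form_complete dotH by exact: pair_dot_complete.
have [s [P sP]] := @range_projector_exists _ _ _ dotH H_complete T T_linear.
have T_ge h := @tensor_sqr_ge0 _ n _ dotG _ lam (fun i => gam i (h i)).
have [||V V_cvg [V_linear V_le]] :=
    range_extension T_linear sP (c := 1) K_complete S1_linear.
- exact: ler01.
- move=> h; rewrite mul1r -(@ler_pXn2r _ 2) ?nnegrE ?fnorm_ge0//.
  by rewrite T_norm lerDl T_ge.
have /choice[L LE] z : exists Lz : H -> H,
    (forall x, form_cvg dotH (S2 z \o s x) (Lz x)) /\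
    (linear Lz /\ forall x, fnorm dotH (Lz x) <= rnorm z * fnorm dotH x).
  have [||Lz Lz1 Lz2] := range_extension T_linear sP (c := rnorm z)
      H_complete (S2_linear z); last by exists Lz.
    exact: rnorm_ge0.
  move=> h; rewrite -(@ler_pXn2r _ 2) ?nnegrE ?mulr_ge0 ?fnorm_ge0 ?rnorm_ge0//.
  rewrite (le_trans (S2_le z h))// exprMn ler_wpM2l ?sqr_ge0// T_norm.
  by rewrite lerDr sqr_ge0.
have L_cvg z x := (LE z).1 x.
have L_linear z : linear (L z) := (LE z).2.1.
have L_le z x : fnorm dotH (L z x) <= rnorm z * fnorm dotH x := (LE z).2.2 x.
have L_linearl x : linear (L^~ x).
  move=> a z w; apply: (form_cvg_unique (L_cvg (a *: z + w) x)).
  rewrite (_ : _ \o _ = fun m => a *: S2 z (s x m) + S2 w (s x m)).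
    exact: (form_cvg_linear a (L_cvg z x) (L_cvg w x)).
  by apply/funext => m; exact: S2_linearl.
have L_fst z x : (L z x).1 = 0.
  have h := form_cvg_fst (L_cvg z x); apply: (form_cvg_unique h).
  exact: form_cvg_cst.
(* Both the norm inequality and the isometry pass to the limit along s x; the
   limit of T (s x n) is P x, which has norm at most |x| and the same inner
   products as x with the range of T. *)
have VL_le z x : rnorm z < 1 ->
    fnorm dot (V x) ^+ 2 + fnorm dotH (L z x) ^+ 2 <= fnorm dotH x ^+ 2.
  move=> z1; apply: (@le_trans _ _ (fnorm dotH (P x) ^+ 2)); last first.
    by rewrite ler_pXn2r ?nnegrE ?fnorm_ge0// (range_projector_le sP).
  have c1 := form_cvg_fnorm (V_cvg x); have c2 := form_cvg_fnorm (L_cvg z x).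
  have c3 := form_cvg_fnorm (sP.1 x); rewrite !expr2.
  apply: (ler_cvg_to (cvgD (cvgM c1 c1) (cvgM c2 c2)) (cvgM c3 c3)).
  apply: nearW => m /=; rewrite -!expr2 !fctE /= -!expr2 T_norm lerD2l.
  rewrite (le_trans (S2_le z _))// ler_piMl ?T_ge//.
  by rewrite expr_le1// ?rnorm_ge0// ltW.
have VL_dot j v x : dot (V x) v + dotH (L (lam j) x) (T (delta j v)) =
    dotH x (T (delta j v)).
  rewrite -[RHS](range_projector_dot sP).
  have c1 := @form_cvg_dot_complex _ _ _ _ _ v (V_cvg x).
  have c2 := @form_cvg_dot_complex _ _ _ _ _ (T (delta j v)) (L_cvg (lam j) x).
  have c3 := @form_cvg_dot_complex _ _ _ _ _ (T (delta j v)) (sP.1 x).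
  have c4 : complex_cvg (fun m => dotH ((T \o s x) m) (T (delta j v)))
      (dot (V x) v + dotH (L (lam j) x) (T (delta j v))).
    under eq_fun do rewrite /= -S_isometry.
    exact: (cvgD c1 c2).
  exact: (cvg_complex_unique c4 c3).
have /choice[N NE] z : exists N : H -> H,
    rnorm z < 1 -> forall x, N x = x + L z (N x).
  have [z1|z1] := pselect (rnorm z < 1); last by exists id => /z1.
  have [||Nz NzE] := @neumann _ _ dotH H_complete (L z) (L_linear z) (rnorm z).
  - by rewrite rnorm_ge0.
  - exact: L_le.
  - by exists Nz.
pose J (u : K) : H := (u, 0).
have J_linear : linear J.
  move=> a x y; apply: pair_ext => //=.
  by rewrite scaler0 addr0.
have J_norm u : fnorm dotH (J u) = rnorm u.
  apply/eqP; rewrite -(@eqrXn2 _ 2) ?fnorm_ge0 ?rnorm_ge0//.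
  by rewrite fnorm_pair_dot/= fnorm0 expr0n addr0 rnormK.
have N_norm z u : rnorm z < 1 -> rnorm (V (N z (J u))) <= rnorm u.
  move=> z1; have := VL_le z (N z (J u)) z1.
  have -> : fnorm dotH (N z (J u)) ^+ 2 =
      rnorm u ^+ 2 + fnorm dotH (L z (N z (J u))) ^+ 2.
    rewrite {1}NE// fnorm_pair_dot [in RHS]fnorm_pair_dot /= L_fst addr0 add0r.
    by rewrite fnorm0 expr0n add0r rnormK.
  by rewrite lerD2r -rnormK ler_pXn2r ?nnegrE ?rnorm_ge0.
have N_linear z : rnorm z < 1 -> linear (N z).
  exact: (@resolvent_linear _ _ _ dotH L N L_linear L_le NE).
have F_bop z : rnorm z < 1 -> is_bop (fun u => V (N z (J u))).
  move=> z1; apply: (@bop_is_bop _ _ _ 1).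
    by move=> a x y; rewrite J_linear N_linear// V_linear.
  by move=> u; rewrite mul1r N_norm.
pose F z : bop K := if pselect (rnorm z < 1) is left z1 then mk_bop (F_bop z z1)
  else 0.
have FE z : rnorm z < 1 -> forall u, F z u = V (N z (J u)).
  by move=> z1 u; rewrite /F; case: pselect.
exists F; split.
- apply: (@transfer_analytic _ _ _ _ dotH L N V J) => //.
  + by move=> x; rewrite rnormK; have := V_le x; rewrite mul1r.
  + by move=> u; rewrite J_norm.
- move=> z u; have [z1|z1] := pselect (rnorm z < 1); first by rewrite FE// N_norm.
  rewrite /F; case: pselect => // _.
  by rewrite -[bopval _ u]/(0 : K) rnorm0 rnorm_ge0.
- move=> j; apply: bop_eq => u; rewrite FE//.
  apply/eqP; rewrite -subr_eq0; apply/eqP; apply: (@dot_eq0l _ _ dot) => v.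
  rewrite dotC dotBl WaE; apply/eqP; rewrite conjC_eq0 subr_eq0; apply/eqP.
  have := VL_dot j v (N (lam j) (J u)); rewrite {3}NE// dotDl => /addIr ->.
  by rewrite T_delta pair_dotE/= linear0l addr0.
Qed.

End lurking_isometry.

(** * Interpolation *)

Section hilbert_completeness.
Context (R : realType) (K : completeNormedModType R[i]).
Context (dot : {dot K for Num.conj}).
Hypothesis hdot : forall x : K, `|x| ^+ 2 = dot x x.

Lemma hilbert_norm x : rnorm x = fnorm dot x.
Proof.
apply/eqP; rewrite -(@eqrXn2 _ 2) ?fnorm_ge0 ?rnorm_ge0//.
by rewrite fnorm_sqr -hdot -rnormE -rmorphXn/=.
Qed.

Lemma hilbert_complete : form_complete dot.
Proof.
move=> u uc; have /cauchy_cvgP/cvg_ex[l ul] : cauchy (u @ \oo).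
  apply: cauchy_exP => e e0.
  have eE : e = (complex.Re e)%:C%C by apply: ge0_ReK; exact: ltW.
  have {}e0 : 0 < complex.Re e by move: e0; rewrite ltcE/= => /andP[].
  have [N h] := uc _ e0; exists (u N); exists N => // m Nm /=.
  by rewrite -ball_normE /ball_/= eE -rnormE ltcR hilbert_norm h.
exists l; apply/cvgrPdist_lt => e e0.
have e0' : 0 < e%:C%C by rewrite ltcE/= eqxx.
move/cvgrPdist_lt : ul => /(_ _ e0'); apply: filterS => m /= h.
rewrite sub0r normrN ger0_norm ?fnorm_ge0// fnormBC -hilbert_norm.
by rewrite -ltcR rnormE.
Qed.

(** The adjoint is chosen by [xget]; the Riesz theorem shows that there is
    something to choose. *)
Lemma adjoint_spec (W : bop K) x y : dot (W x) y = dot x (adjoint dot W y).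
Proof.
have [M M0 WM] := is_bop_bound W.
have [|g [g_linear gE gM]] :=
    bounded_adjoint (dotW := dot) hilbert_complete (bop_linear W) M0.
  by move=> u; rewrite -!hilbert_norm.
have gb : is_bop g.
  by apply: (bop_is_bop (M := M)) => // u; rewrite !hilbert_norm.
have h : [set S : bop K | forall x y, dot (W x) y = dot x (S y)] (mk_bop gb).
  by move=> u v; exact: gE.
exact: (xgetPex 0 (ex_intro _ _ h)).
Qed.

End hilbert_completeness.

Theorem corollary2p7 (R : realType) (n : option nat) (hn : n <> Some 0%N)
    (K : completeNormedModType R[i]) (dot : {dot K for Num.conj})
    (hdot : forall x : K, `|x| ^+ 2 = dot x x)
    (k : nat) (lam : 'I_k -> l2 R n) (W : 'I_k -> bop K)
    (lam_inj : injective lam) (lam_ball : forall j, l2ball R n (lam j))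
    (W_pos : forall h : 'I_k -> K,
      0 <= \sum_(i < k) \sum_(j < k)
             dot (h i - W j (adjoint dot (W i) (h i))) (h j)
               / (1 - l2dot (lam j) (lam i))) :
  exists F : l2 R n -> bop K,
    [/\ analytic_on (l2ball R n) F,
        (ereal_sup [set (rnorm (F z))%:E | z in l2ball R n] <= 1)%E &
        forall j, F (lam j) = W j].
Proof.
have Kc := hilbert_complete hdot; have Kn := hilbert_norm hdot.
have lam1 j : rnorm (lam j) < 1.
  by have := lam_ball j; rewrite /l2ball /= -rnormE -[1]/(1%:C)%C ltcR.
pose D j i := 1 - l2dot (lam j) (lam i).
have D0 j i : D j i != 0.
  rewrite subr_eq0; apply/eqP => D1.
  have := rnorm_l2dot_le (lam j) (lam i); rewrite -D1 -[1]/(1%:C)%C rnorm_real normr1.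
  apply/negP; rewrite -ltNge.
  by rewrite -[ltRHS]mulr1 ltr_pM ?rnorm_ge0.
pose A i := adjoint dot (W i).
pose Gam (h : 'I_k -> K) : 'I_k -> K :=
  fun j => \sum_i (D j i)^-1 *: (h i - W j (A i (h i))).
have Gam_linear : linear Gam.
  move=> a x y; apply/funext => j; rewrite /Gam !fctE scaler_sumr -big_split.
  apply: eq_bigr => i _ /=; rewrite (bop_linear (A i)) (bop_linear (W j)).
  by rewrite opprD addrACA -scalerBr scalerDr !scalerA mulrC.
have Gam_dot h : (sum_dot dot : {dot _ for Num.conj}) (Gam h) h =
    \sum_(i < k) \sum_(j < k) dot (h i - W j (A i (h i))) (h j) / D j i.
  rewrite -[LHS]/(\sum_j dot (Gam h j) (h j)) [RHS]exchange_big.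
  apply: eq_bigr => j _ /=; rewrite dot_suml.
  by apply: eq_bigr => i _; rewrite dotZl mulrC.
have [M M0 Gam_le] : exists2 M : R, 0 < M &
    forall h, fnorm (sum_dot dot) (Gam h) <= M * fnorm (sum_dot dot) h.
  have /choice[w wP] (T : bop K) : exists c : R,
      0 <= c /\ forall u, fnorm dot (T u) <= c * fnorm dot u.
    have [c c0 Tc] := is_bop_bound T; exists c; split=> // u.
    by rewrite -!Kn.
  pose c j i := rnorm (D j i)^-1 * (1 + w (W j) * w (A i)).
  have c0 j i : 0 <= c j i.
    by rewrite mulr_ge0 ?rnorm_ge0// addr_ge0// mulr_ge0// (wP _).1.
  (* the summand 1 makes the bound positive, also when k = 0 *)
  exists (1 + \sum_j \sum_i c j i).
    by rewrite ltr_pwDl// sumr_ge0// => j _; rewrite sumr_ge0.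
  move=> h; apply: le_trans (fnorm_sum_dot_le _ _) _.
  apply: (@le_trans _ _ ((\sum_j \sum_i c j i) * fnorm (sum_dot dot) h)); last first.
    by rewrite ler_wpM2r ?fnorm_ge0// lerDr.
  rewrite mulr_suml; apply: ler_sum => j _; rewrite mulr_suml.
  apply: (@le_trans _ _ (\sum_i fnorm dot ((D j i)^-1 *: (h i - W j (A i (h i)))))).
    rewrite /Gam; elim/big_rec2: _ => [|i u v _ h1]; first by rewrite fnorm0.
    by rewrite (le_trans (fnormD _ _ _))// lerD2l.
  apply: ler_sum => i _; rewrite fnormZ -mulrA ler_wpM2l ?rnorm_ge0//.
  apply: (@le_trans _ _ ((1 + w (W j) * w (A i)) * fnorm dot (h i))).
    rewrite (le_trans (fnormD _ _ _))// fnormN mulrDl mul1r lerD2l.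
    by rewrite (le_trans ((wP _).2 _))// -mulrA ler_wpM2l ?(wP _).1 ?(wP _).2.
  by rewrite ler_wpM2l ?fnorm_le_sum_dot// addr_ge0// mulr_ge0// (wP _).1.
have [||B B_linear BE] :=
    positive_factor (sum_dot_complete (I := 'I_k) Kc) Gam_linear M0.
- by move=> h; rewrite Gam_dot; exact: W_pos.
- move=> h; rewrite (le_trans (Re_le_rnorm _))// (le_trans (CauchySchwarz_dot _ _ _))//.
  by rewrite expr2 mulrA ler_wpM2r ?fnorm_ge0.
(* the factor gam_i u := B (delta i u) of the positive operator matrix *)
pose delta i (u : K) : 'I_k -> K := fun j => if j == i then u else 0.
have delta_linear i : linear (delta i).
  move=> a x y; apply/funext => j; rewrite /delta !fctE.
  by case: ifP => // _; rewrite scaler0 addr0.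
have [|i||i j u v|F [F_an F_le F_lam]] := @lurking_isometry R n K dot Kc Kn _
    (sum_dot dot) (sum_dot_complete (I := 'I_k) Kc) _ lam W A lam1 _ _
    (fun i u => B (delta i u)).
- by move=> i; exact: bop_linear.
- by move=> x y; exact: adjoint_spec.
- by move=> i a x y; rewrite delta_linear B_linear.
- rewrite !BE.
  have -> : (sum_dot dot : {dot _ for Num.conj}) (Gam (delta i u)) (delta j v) =
      (D j i)^-1 * (dot u v - dot (A i u) (A j v)).
    rewrite -[LHS]/(\sum_l dot (Gam (delta i u) l) (delta j v l)).
    rewrite (bigD1 j)//= big1 => [|l /negbTE lj]; last by rewrite /delta lj linear0r.
    rewrite addr0 /Gam (bigD1 i)//= big1 => [|l /negbTE li]; last first.
      by rewrite /delta li !bop0 subr0 scaler0.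
    by rewrite addr0 /delta !eqxx dotZl dotBl (adjoint_spec hdot).
  have -> : l2dot (lam j) (lam i) = 1 - D j i by rewrite opprB addrC subrK.
  by field.
exists F; split=> //.
apply: ge_ereal_sup => _ [z _ <-]; rewrite lee_fin.
by apply: bop_norm_le => // u; rewrite mul1r.
Qed.
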